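(* (1) For the diametrical-path estimator $\Psi$, $$\liminf_{n\to\infty}\ \inf_{v\in\mathbb{Z}^d}\mathbb{P}_v\big(\Psi(G_n^{\mathbb{Z}^d})=v\big)=\tfrac12-O(1/d)\quad\text{as } d\to\infty.$$ That is, there exist constants $C>0$ and $d_0$ such that for all $d\ge d_0$ the left-hand side differs from $1/2$ by at most $C/d$. (2) For every estimator $\Phi$, $$\limsup_{n\to\infty}\ \inf_{v\in\mathbb{Z}^d}\mathbb{P}_v\big(\Phi(G_n^{\mathbb{Z}^d})=v\big)=\tfrac12-\Omega(1/d)\quad\text{as } d\to\infty.$$ That is, there exist constants $c>0$ and $d_0$ such that for all $d\ge d_0$ and every estimator $\Phi$ on $\mathbb{Z}^d$ the left-hand side is at most $\tfrac12-\tfrac{c}{d}$.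
   Context: $(X_n)_{n\ge0}$ is the simple random walk on the nearest-neighbour lattice $\mathbb{Z}^d$; $\mathbb{P}_v$ is its law when started at the source $X_0=v$. The $n$-step trace $G_n^{\mathbb{Z}^d}$ is the subgraph of $\mathbb{Z}^d$ consisting of the vertices $X_0,\dots,X_n$ and the edges $\{X_i,X_{i+1}\}$, $0\le i<n$ (as an embedded graph, i.e. its actual vertex and edge sets in $\mathbb{Z}^d$ are known). An estimator $\Phi$ (on $\mathbb{Z}^d$) is a function taking as input an embedded graph $G\subseteq\mathbb{Z}^d$ and outputting a vertex of $\mathbb{Z}^d$; the output may be random, conditionally on the trace (i.e. given $G$ it is drawn from a distribution depending only on $G$, independently of the walk otherwise). Estimators need not be translation invariant. For a finite connected graph $G$, a diametrical path is a path in $G$ of length $\mathrm{diam}(G)$ joining two vertices at graph distance $\mathrm{diam}(G)$. The estimator $\Psi$, on input $G$, selects a uniformly random diametrical path of $G$ and outputs one of its two endpoints uniformly at random. *)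

(* Defs.v *)
From HB Require Import structures.
From mathcomp Require Import all_boot all_order all_algebra finmap.
From mathcomp Require Import boolp classical_sets reals ereal constructive_ereal.
From mathcomp Require Import sequences esum.

Set Implicit Arguments.
Unset Strict Implicit.
Unset Printing Implicit Defensive.

Import Order.TTheory GRing.Theory Num.Theory.
Local Open Scope fset_scope.
Local Open Scope ring_scope.

Definition lattice (d : nat) : choiceType := 'rV[int]_d.

Definition lattice_adj (d : nat) (x y : 'rV[int]_d) : bool :=
  \sum_(i < d) `|x ord0 i - y ord0 i| == 1.

(* Finite embedded subgraphs of Z^d; an edge is the unordered pair [fset x; y]. *)
Record egraph (d : nat) := EGraph {
  gV : {fset lattice d};
  gE : {fset {fset lattice d}};
  egraphP : [forall e : gE, exists x : gV, exists y : gV,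
    (val e == [fset val x; val y]) && lattice_adj (val x) (val y)]
}.

Section Walk.
Variable d : nat.

(* A nearest-neighbour step: (i, false) is +e_i and (i, true) is -e_i. *)
Definition direction : finType := ('I_d * bool)%type.

Definition step (a : direction) : 'rV[int]_d :=
  (-1) ^+ a.2 *: delta_mx ord0 a.1.

Definition position n (v : 'rV[int]_d) (s : n.-tuple direction) (i : nat)
    : lattice d :=
  v + \sum_(j < n | (j < i)%N) step (tnth s j).

Definition trace_V n v (s : n.-tuple direction) : {fset lattice d} :=
  [fset position v s (i : 'I_n.+1) | i in 'I_n.+1].

Definition trace_E n v (s : n.-tuple direction) : {fset {fset lattice d}} :=
  [fset [fset position v s (i : 'I_n); position v s i.+1] | i in 'I_n].

Lemma positionS n v (s : n.-tuple direction) (i : 'I_n) :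
  position v s i.+1 = position v s i + step (tnth s i).
Proof.
rewrite /position -addrA; congr (_ + _).
rewrite (bigD1 i) //= addrC; congr (_ + _).
by apply: eq_bigl => j; rewrite ltnS -(inj_eq val_inj) ltn_neqAle andbC.
Qed.

Lemma lattice_adj_step (x : 'rV[int]_d) (a : direction) :
  lattice_adj x (x + step a).
Proof.
rewrite /lattice_adj (bigD1 a.1) //= big1 => [|i ne_i].
  by rewrite !mxE !eqxx mulr1 opprD addNKr normrN normr_sign addr0.
by rewrite !mxE (negPf ne_i) andbF mulr0 addr0 subrr normr0.
Qed.

Lemma trace_subproof n v (s : n.-tuple direction) :
  [forall e : trace_E v s, exists x : trace_V v s, exists y : trace_V v s,
    (val e == [fset val x; val y]) && lattice_adj (val x) (val y)].
Proof.
apply/forallP => -[e /= /imfsetP[i /= _ ->]].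
have in_V (k : nat) : (k < n.+1)%N -> position v s k \in trace_V v s.
  by move=> lt_k; apply/imfsetP; exists (Ordinal lt_k).
apply/existsP; exists [` in_V i (ltnW (ltn_ord i))].
apply/existsP; exists [` in_V i.+1 (ltn_ord i)] => /=.
by rewrite eqxx /= positionS lattice_adj_step.
Qed.

Definition trace n v (s : n.-tuple direction) : egraph d :=
  EGraph (trace_subproof v s).

End Walk.

Section Diametrical.
Variables (d : nat) (G : egraph d).

Definition gadj : rel (gV G) := fun x y => [fset val x; val y] \in gE G.

(* [x :: p] is the vertex sequence of a path of length [size p] in G. *)
Definition gpath (x : gV G) (p : seq (gV G)) : bool :=
  path gadj x p && uniq (x :: p).

(* If y is not reachable from x, the value is the junk #|` gV G|. *)
Definition gdist (x y : gV G) : nat :=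
  find (fun k => [exists p : k.-tuple (gV G), gpath x p && (last x p == y)])
       (iota 0 #|` gV G|).

Definition gdiam : nat := \max_(x : gV G) \max_(y : gV G) gdist x y.

(* Diametrical paths as vertex sequences: start vertex and the gdiam others.
   For gdiam > 0 each undirected path is counted exactly twice, once for each
   orientation; hence a uniform element of this set is a uniform undirected
   diametrical path with a uniform orientation. *)
Definition diametrical : {set gV G * gdiam.-tuple (gV G)} :=
  [set q : gV G * gdiam.-tuple (gV G) |
     gpath q.1 q.2 && (gdist q.1 (last q.1 q.2) == gdiam)].

End Diametrical.

Section Estimators.
Variables (R : realType) (d : nat).

(* [Phi G w] is the conditional probability of output w given the trace G. *)
Definition is_estimator (Phi : egraph d -> lattice d -> R) : Prop :=
  forall G, (forall w, 0 <= Phi G w) /\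
    \esum_(w in [set: lattice d]%classic) (Phi G w)%:E = 1%E.

(* A uniform diametrical path, then a uniform endpoint of it. Meaningful for
   nonempty connected G, as are all traces. *)
Definition Psi (G : egraph d) (w : lattice d) : R :=
  \sum_(q in diametrical G) #|diametrical G|%:R^-1 *
    (2^-1 * (val q.1 == w)%:R + 2^-1 * (val (last q.1 q.2) == w)%:R).

(* P_v(Phi(G_n) = v): under P_v the n first steps are i.i.d. uniform over the
   2d directions, so each of the (2d)^n step sequences has the same weight. *)
Definition success_prob (Phi : egraph d -> lattice d -> R) (n : nat)
    (v : lattice d) : R :=
  \sum_(s : n.-tuple (direction d)) (2 * d)%:R ^- n * Phi (trace v s) v.

Definition worst_success_prob (Phi : egraph d -> lattice d -> R) (n : nat)
    : \bar R :=
  ereal_inf (range (fun v : lattice d => (success_prob Phi n v)%:E)).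

End Estimators.

(* Main.v *)
Require Import Defs.
From mathcomp Require Import all_boot all_order all_algebra finmap.
From mathcomp Require Import boolp classical_sets fsbigop reals ereal.
From mathcomp Require Import sequences esum.
From mathcomp Require Import zify ring lra.

(** Read backwards, a walk has the same trace and the same probability, so an
estimator can only guess which of the two ends is the source.  This is where 1/2
comes from; the two parts of the theorem say that the loss with respect to 1/2 is
at most of order 1/d for the diametrical path, and at least of that order for
every estimator.

Lower bound for the diametrical path.  Call a step of the walk a cut when no
closed piece of the walk runs over it.  Step k fails to be a cut with probability
at most the sum over l of l * P(X_l = 0), and this is O(1/d)
([sum_return_prob]): closed words are counted with multinomial coefficients,
which are largest for balanced compositions ([return_prob_even], [beta_ub]).  A
maximal inequality improves this to a statement about all times at once: with
probability 1 - O(1/d), for every i >= 1 more than half of the first i steps are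
cuts ([heavy_prob]).  On that event X_0 is strictly farther from X_j than X_i is,
for all 1 <= i <= j: a geodesic from X_0 to X_j runs through all cuts before time
i, and they outnumber the steps that lead X_i back to the last of them
([start_is_farther]).  So every diametrical path ends at X_0
([diametrical_start]), and a random endpoint of it is X_0 with probability at
least 1/2.

Upper bound for all estimators.  An estimator need not commute with translations,
so the source is averaged over a box that is large compared to the length of the
walk; translating the box then costs nothing in the limit ([box_ratio]).
Averaging over a walk and its reversal gives 1/2.  The loss of order 1/d comes
from walks that begin with a backtrack, that is, with steps a, -a, t, z where a
and z are single steps and t is a word.  The walk with steps -a, t, z, -z that
starts one step later has the same trace: the initial backtrack has become a
final one ([wtrace_slide]).  Together with the two reversals this gives four
equally likely walks with the same trace and, most of the time, four different
sources, so that the estimator is right at most once in four times on an event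
whose probability is about 1/d ([four_starts], [box_sum_success]). *)

Set Implicit Arguments.
Unset Strict Implicit.
Unset Printing Implicit Defensive.
Import Order.TTheory GRing.Theory Num.Theory.
Local Open Scope ring_scope.

(** * Uniform random words *)
Section Mean.
Variables (R : realType) (A : finType).
Implicit Types (g h : seq A -> R) (n m : nat).

(** The expectation of [g] over a uniform word of length [n].  Functions of
sequences, and recursion on the first letter, allow a word to be cut anywhere
without casts between tuple types. *)
Fixpoint mean n g : R :=
  if n is m.+1 then #|A|%:R^-1 * \sum_a mean m (fun s => g (a :: s)) else g [::].

Lemma eq_mean n g h : (forall s, size s = n -> g s = h s) -> mean n g = mean n h.
Proof.
elim: n g h => [|n IHn] g h eq_gh /=; first exact: eq_gh.
by congr (_ * _); apply: eq_bigr => a _; apply: IHn => s /= sz; rewrite eq_gh //= sz.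
Qed.

Lemma ler_mean n g h : (forall s, size s = n -> g s <= h s) -> mean n g <= mean n h.
Proof.
elim: n g h => [|n IHn] g h le_gh /=; first exact: le_gh.
rewrite ler_wpM2l ?invr_ge0 ?ler0n //; apply: ler_sum => a _.
by apply: IHn => s /= sz; rewrite le_gh //= sz.
Qed.

Lemma meanD n g h : mean n (fun s => g s + h s) = mean n g + mean n h.
Proof.
elim: n g h => [|n IHn] g h //=.
by rewrite -mulrDr -big_split; congr (_ * _); apply: eq_bigr => a _; rewrite IHn.
Qed.

Lemma meanZ n x g : mean n (fun s => x * g s) = x * mean n g.
Proof.
elim: n g => [|n IHn] g //=.
by rewrite mulrCA; congr (_ * _); rewrite mulr_sumr; apply: eq_bigr => a _; rewrite IHn.
Qed.

Lemma mean0 n : mean n (fun=> 0) = 0.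
Proof. by have := meanZ n 0 (fun=> 0); rewrite !mul0r. Qed.

Lemma mean_ge0 n g : (forall s, size s = n -> 0 <= g s) -> 0 <= mean n g.
Proof. by move=> g_ge0; rewrite -[X in X <= _](mean0 n); apply: ler_mean. Qed.

Lemma mean_sum n I (r : seq I) (P : pred I) (F : I -> seq A -> R) :
  mean n (fun s => \sum_(i <- r | P i) F i s) = \sum_(i <- r | P i) mean n (F i).
Proof.
elim: r => [|i r IHr].
  by rewrite big_nil -[RHS](mean0 n); apply: eq_mean => s _; rewrite big_nil.
rewrite big_cons; case: ifP => Pi; rewrite -IHr -?meanD; apply: eq_mean => s _.
  by rewrite big_cons Pi.
by rewrite big_cons Pi.
Qed.

Lemma mean_cat m n g :
  mean (m + n) g = mean m (fun s => mean n (fun t => g (s ++ t))).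
Proof.
elim: m g => [|m IHm] g //=.
by congr (_ * _); apply: eq_bigr => a _; rewrite IHm.
Qed.

Lemma mean_tuple n g : mean n g = \sum_(s : n.-tuple A) #|A|%:R ^- n * g s.
Proof.
elim: n g => [|n IHn] g /=.
  rewrite (big_pred1 [tuple]) => [|t]; first by rewrite expr0 invr1 mul1r.
  by rewrite (tuple0 t) /= eqxx.
under eq_bigr do rewrite IHn.
rewrite pair_big /= mulr_sumr.
rewrite (reindex (fun p : A * n.-tuple A => [tuple of p.1 :: p.2])) /=; last first.
  exists (fun t : n.+1.-tuple A => (thead t, [tuple of behead t])) => [[a t] _|t _].
    by congr (_, _); apply: val_inj.
  by rewrite [RHS]tuple_eta.
apply: eq_bigr => -[a t] _ /=.
by rewrite exprS invfM mulrA.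
Qed.

Lemma mean_rev n g : mean n (fun s => g (rev s)) = mean n g.
Proof.
rewrite !mean_tuple (reindex_inj (h := fun t : n.-tuple A => [tuple of rev t])) /=.
  by apply: eq_bigr => t _; rewrite revK.
by move=> s t /(congr1 val) /= /(can_inj revK) /val_inj.
Qed.

Lemma mean_map n g (f : A -> A) : injective f ->
  mean n (fun s => g (map f s)) = mean n g.
Proof.
move=> f_inj; rewrite [RHS]mean_tuple.
rewrite (reindex_inj (h := fun t : n.-tuple A => [tuple of map f t])) /=.
  by rewrite mean_tuple.
by move=> s t /(congr1 val) /= /(inj_map f_inj) /val_inj.
Qed.

Hypothesis A_gt0 : (0 < #|A|)%N.

Lemma mean_cst n x : mean n (fun=> x) = x.
Proof.
elim: n => [|n IHn] //=.
by rewrite IHn sumr_const -[x *+ _]mulr_natl mulKf // pnatr_eq0 -lt0n cardT -cardE.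
Qed.

(** Letters at distinct places are independent, so every factor of a uniform word
is a uniform word. *)
Lemma mean_window N i l g : (i + l <= N)%N ->
  mean N (fun s => g (take l (drop i s))) = mean l g.
Proof.
move=> /subnKC <-; rewrite -addnA !mean_cat.
under eq_mean => s sz_s.
  rewrite mean_cat.
  under eq_mean => t sz_t.
    under eq_mean => u _ do rewrite drop_size_cat // take_size_cat //.
    rewrite mean_cst.
  over.
over.
by rewrite mean_cst.
Qed.

End Mean.

(** * Return probabilities *)
Section Multinomial.
Variables (R : realType) (A : finType).

(** The multinomial law.  Induction on the length: removing the first letter [a]
lowers the count of [a], and contributes [c a] times a factorial of [l]. *)
Lemma mean_count l (c : A -> nat) : (\sum_a c a = l)%N ->
  mean l (fun s => [forall a, count_mem a s == c a]%:R : R)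
    * (\prod_a (c a)`!)%:R * #|A|%:R ^+ l = l`!%:R.
Proof.
elim: l c => [|l IHl] c sum_c /=.
  have c0 a : c a = 0 by apply/eqP; move/eqP: sum_c; rewrite sum_nat_eq0 => /forallP/(_ a).
  rewrite big1 => [|a _]; last by rewrite c0.
  by rewrite expr0 !mulr1; case: forallP => // -[] a; rewrite c0.
have [a0 _|A0] := pickP A; last by move: sum_c; rewrite big_pred0 // => a; exact: A0.
have A_neq0 : #|A|%:R != 0 :> R by rewrite pnatr_eq0 -lt0n; apply/card_gt0P; exists a0.
have term a : mean l (fun s => [forall b, count_mem b (a :: s) == c b]%:R : R)
    * (\prod_b (c b)`!)%:R * #|A|%:R ^+ l = (c a * l`!)%:R.
  have [ca0|ca_gt0] := posnP (c a).
    rewrite ca0 mul0n (eq_mean (h := fun=> 0)) ?mean0 ?mul0r // => s _.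
    by case: forallP => // /(_ a); rewrite /= eqxx ca0.
  pose c' b := (c b - (a == b))%N.
  have c'a : c' a = (c a).-1 by rewrite /c' eqxx subn1.
  have sum_c' : (\sum_b c' b = l)%N.
    apply: succn_inj; rewrite -sum_c (bigD1 a) //= [in RHS](bigD1 a) //= c'a.
    rewrite -addSn prednK //; congr (_ + _)%N.
    by apply: eq_bigr => b /negPf ne_ba; rewrite /c' eq_sym ne_ba subn0.
  rewrite natrM -(IHl c') // (bigD1 a) //= [in RHS](bigD1 a) //= c'a.
  have -> : (\prod_(b | b != a) (c b)`! = \prod_(b | b != a) (c' b)`!)%N.
    by apply: eq_bigr => b /negPf ne_ba; rewrite /c' eq_sym ne_ba subn0.
  rewrite -[in (c a)`!](prednK ca_gt0) factS prednK // -mulnA [(c a * _)%:R]natrM.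
  rewrite mulrA -[_ * (c a)%:R]mulrC -!mulrA; congr (_ * (_ * _)).
  apply: eq_mean => s _; congr ((nat_of_bool _)%:R).
  apply: eq_forallb => b; rewrite /c' /=; have [<-|_] := eqVneq a b; apply/eqP/eqP; lia.
set S := \sum_a _; set P := (\prod_a _)%:R.
have -> : #|A|%:R^-1 * S * P * #|A|%:R ^+ l.+1 = S * (P * #|A|%:R ^+ l).
  by rewrite exprS; field.
rewrite /S mulr_suml; transitivity (\sum_a (c a * l`!)%:R : R).
  by apply: eq_bigr => a _; rewrite mulrA term.
by rewrite -natr_sum -big_distrl /= sum_c factS.
Qed.
End Multinomial.

Section Beta.
Variables (R : realType) (d : nat).

(** The largest multinomial weight m! / (d^m prod_i c_i!) of a composition c of m
into d parts.  It is built up by adding one to a smallest part, whose size goes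
from [t %/ d] to [(t %/ d).+1] at step [t]. *)
Definition beta m : R := \prod_(t < m) (t.+1%:R / (d * (t %/ d).+1)%:R).

Lemma betaS m : beta m.+1 = beta m * (m.+1%:R / (d * (m %/ d).+1)%:R).
Proof. by rewrite /beta big_ord_recr. Qed.

Hypothesis d_gt0 : (0 < d)%N.

Lemma beta_gt0 m : 0 < beta m.
Proof. by apply: prodr_gt0 => t _; rewrite divr_gt0 // ltr0n ?muln_gt0 ?d_gt0. Qed.

(** By pigeonhole some part exceeds [m %/ d]; removing one from it changes the
weight by at most the last factor of [beta]. *)
Lemma multinomial_le_beta m (c : 'I_d -> nat) : (\sum_i c i = m)%N ->
  m`!%:R <= beta m * d%:R ^+ m * (\prod_i (c i)`!)%:R.
Proof.
elim: m c => [|m IHm] c sum_c.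
  rewrite /beta big_ord0 expr0 !mul1r ler_nat prodn_gt0 // => i; exact: fact_gt0.
have [i ci_big] : exists i, (m %/ d < c i)%N.
  apply/existsP; apply: contraT; rewrite negb_exists => /forallP c_small.
  suff : (\sum_i c i <= d * (m %/ d))%N.
    rewrite sum_c mulnC => /leq_trans/(_ (leq_trunc_div m d)); rewrite ltnn //.
  have -> : (d * (m %/ d) = \sum_(i < d) (m %/ d))%N by rewrite sum_nat_const card_ord.
  apply: leq_sum => i _.
  by rewrite leqNgt.
pose c' j := (c j - (i == j))%N.
have c'i : c' i = (c i).-1 by rewrite /c' eqxx subn1.
have ci_gt0 : (0 < c i)%N by apply: leq_ltn_trans ci_big.
have sum_c' : (\sum_j c' j = m)%N.
  apply: succn_inj; rewrite -sum_c (bigD1 i) //= [in RHS](bigD1 i) //= c'i.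
  rewrite -addSn prednK //; congr (_ + _)%N.
  by apply: eq_bigr => j /negPf ne_ji; rewrite /c' eq_sym ne_ji subn0.
have -> : (\prod_j (c j)`! = c i * \prod_j (c' j)`!)%N.
  rewrite (bigD1 i) //= [in RHS](bigD1 i) //= c'i mulnA.
  rewrite -[in (c i)`!](prednK ci_gt0) factS prednK //; congr (_ * _)%N.
  by apply: eq_bigr => j /negPf ne_ji; rewrite /c' eq_sym ne_ji subn0.
rewrite factS !natrM; set P := (\prod_j _)%:R.
apply: le_trans (ler_wpM2l _ (IHm _ sum_c')) _; first exact: ler0n.
have -> : beta m.+1 * d%:R ^+ m.+1 * ((c i)%:R * P) =
    m.+1%:R * (beta m * d%:R ^+ m * P) * ((c i)%:R / (m %/ d).+1%:R).
  rewrite betaS natrM exprS; field; apply/andP; split; rewrite ?pnatr_eq0 -?lt0n //.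
rewrite ler_peMr //.
  by rewrite !mulr_ge0 ?exprn_ge0 ?ler0n // ltW ?beta_gt0.
by rewrite ler_pdivlMr ?ltr0n // mul1r ler_nat.
Qed.

End Beta.

Section Return.
Variables (R : realType) (d : nat).
Hypothesis d_gt0 : (0 < d)%N.
Local Notation dir := (direction d).

Definition disp (s : seq dir) : 'rV[int]_d := \sum_(a <- s) step a.

Lemma disp_cat s t : disp (s ++ t) = disp s + disp t.
Proof. exact: big_cat. Qed.

Lemma disp_cons a s : disp (a :: s) = step a + disp s.
Proof. exact: big_cons. Qed.

Lemma disp_nil : disp [::] = 0.
Proof. exact: big_nil. Qed.

Lemma disp_coord s i :
  disp s ord0 i = (count_mem (i, false) s)%:Z - (count_mem (i, true) s)%:Z.
Proof.
elim: s => [|[j b] s IHs]; first by rewrite disp_nil mxE.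
rewrite disp_cons mxE IHs /= !mxE !xpair_eqE /= eq_sym.
by case: b; case: (j == i) => /=; lia.
Qed.

Lemma size_sum_count (A : finType) (s : seq A) : size s = (\sum_a count_mem a s)%N.
Proof.
elim: s => [|a s IHs]; first by rewrite big1.
rewrite /= IHs big_split /= -add1n; congr (_ + _)%N.
rewrite (bigD1 a) //= eqxx big1 ?addn0 //.
by move=> b; rewrite eq_sym => /negPf->.
Qed.

Lemma sum_dir (F : dir -> nat) :
  (\sum_a F a = \sum_i (F (i, false) + F (i, true)))%N.
Proof.
transitivity (\sum_i \sum_(b : bool) F (i, b))%N.
  by rewrite pair_big; apply: eq_bigr => -[].
by apply: eq_bigr => i _; rewrite big_bool addnC.
Qed.

Lemma disp0_count s i : disp s = 0 -> count_mem (i, true) s = count_mem (i, false) s.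
Proof. by move=> /rowP/(_ i); rewrite disp_coord mxE => /eqP; rewrite subr_eq0 => /eqP [->]. Qed.

(** A closed word has as many steps in each direction as in the opposite one. *)
Lemma disp0_size s : disp s = 0 ->
  size s = (\sum_i count_mem (i, false) s)%N.*2.
Proof.
move=> s0; rewrite size_sum_count sum_dir -muln2 big_distrl /=.
by apply: eq_bigr => i _; rewrite disp0_count // muln2 addnn.
Qed.

Definition return_prob l : R := mean l (fun s : seq dir => (disp s == 0)%:R).

Lemma return_prob_odd l : odd l -> return_prob l = 0.
Proof.
move=> odd_l; rewrite -(mean0 R dir l); apply: eq_mean => s sz_s.
case: eqP => // /disp0_size sz2; move: odd_l.
by rewrite -sz_s sz2 odd_double.
Qed.

(** A closed word of length 2m has c_i steps in direction e_i and as many in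
direction -e_i.  The share of the words with given counts c is
binomial(2m, m) / 4^m times the square of [M c], the probability that a uniform
word over the d coordinates has counts c.  One factor [M c] is at most
[beta R d m], and the other one sums to at most 1. *)
Lemma return_prob_even m : return_prob m.*2 <= beta R d m.
Proof.
pose T := {ffun 'I_d -> 'I_m.+1}.
pose M (c : T) : R := mean m (fun s => [forall i, count_mem i s == c i]%:R).
have M_ge0 c : 0 <= M c by apply: mean_ge0 => s _; rewrite ler0n.
have sumM : \sum_(c : T | (\sum_i c i == m)%N) M c <= 1.
  apply: le_trans (_ : \sum_c M c <= 1).
    by rewrite big_mkcond; apply: ler_sum => c _; case: ifP.
  have ord_gt0 : (0 < #|'I_d|)%N by rewrite card_ord.
  rewrite -mean_sum -[leRHS](mean_cst ord_gt0 m).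
  apply: ler_mean => s _.
  have [c0 /forallP c0P|none] := pickP (fun c : T => [forall i, count_mem i s == c i]).
    rewrite (bigD1 c0) //= big1 ?addr0 ?lern1 ?leq_b1 // => c ne_c.
    case: forallP => // cP; case/eqP: ne_c; apply/ffunP => i.
    by apply: val_inj => /=; move/eqP: (cP i); move/eqP: (c0P i) => -> ->.
  by rewrite big1 // => c _; rewrite none.
have term (c : T) : (\sum_i c i = m)%N ->
    mean m.*2 (fun s => [forall a : dir, count_mem a s == c a.1]%:R) <= beta R d m * M c.
  move=> sum_c.
  have sum_c2 : (\sum_(a : dir) c a.1 = m.*2)%N.
    by rewrite sum_dir /= big_split /= sum_c addnn.
  have := mean_count R sum_c2; have := mean_count R sum_c.
  rewrite -/(M c) card_ord card_prod card_bool card_ord.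
  have -> : (\prod_(a : dir) (c a.1)`! = (\prod_i (c i)`!) * (\prod_i (c i)`!))%N.
    transitivity (\prod_i \prod_(b : bool) (c i)`!)%N.
      by rewrite pair_big; apply: eq_bigr => -[].
    rewrite -big_split /=; by apply: eq_bigr => i _; rewrite big_bool.
  set P := (\prod_i _)%N; set M2 := mean _ _ => defM defM2.
  have P_gt0 : (0 < P%:R :> R) by rewrite ltr0n prodn_gt0 // => i; exact: fact_gt0.
  have D_gt0 : (0 < d%:R :> R) by rewrite ltr0n.
  have M_beta : M c <= beta R d m.
    have := multinomial_le_beta R d_gt0 sum_c; rewrite -/P -defM mulrAC.
    by rewrite ler_pM2r // ler_pM2r ?exprn_gt0.
  apply: le_trans (_ : M c * M c <= _); last by rewrite ler_wpM2r.
  have bin_le : 'C(m.*2, m)%:R <= 4 ^+ m :> R.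
    rewrite -natrX ler_nat -[4%N]/(2 ^ 2)%N -expnM mul2n [(2 ^ _)%N](expnDn 1 1).
    have lt_m : (m < m.*2.+1)%N by rewrite ltnS -addnn leq_addr.
    by rewrite (bigD1 (Ordinal lt_m)) //= !exp1n !muln1 leq_addr.
  have fact2 : (m.*2)`!%:R = 'C(m.*2, m)%:R * (m`!%:R * m`!%:R) :> R.
    rewrite -!natrM -(bin_fact (n := m.*2) (m := m)) -?addnn ?leq_addr //.
    by rewrite addnK.
  have K_gt0 : 0 < (P * P)%:R * (2 * d)%:R ^+ m.*2 :> R.
    rewrite natrM !mulr_gt0 // exprn_gt0 // ltr0n; lia.
  rewrite -(ler_pM2r K_gt0) mulrA (mulnC 2%N) defM2 fact2 -defM.
  have -> : (d * 2)%:R ^+ m.*2 = d%:R ^+ m * d%:R ^+ m * 4 ^+ m :> R.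
    have -> : 4 = 2 * 2 :> R by rewrite -natrM.
    by rewrite natrM !exprMn -!addnn !exprD; ring.
  rewrite (natrM R P P).
  have := ler_wpM2r (exprn_ge0 2 (mulr_ge0 (mulr_ge0 (M_ge0 c) (ltW P_gt0))
    (ltW (exprn_gt0 m D_gt0)))) bin_le.
  by rewrite expr2; move/le_trans; apply; rewrite le_eqVlt; apply/orP; left; apply/eqP; ring.
apply: le_trans (_ : \sum_(c : T | (\sum_i c i == m)%N) beta R d m * M c <= _); last first.
  by rewrite -mulr_sumr ler_piMr // ltW ?beta_gt0.
apply: le_trans (ler_sum _ (fun c sum_c => term c (eqP sum_c))).
rewrite -mean_sum; apply: ler_mean => s sz_s.
have [s0|_] := eqVneq (disp s) 0; last by apply: sumr_ge0 => c _; exact: ler0n.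
have sum_s : (\sum_i count_mem (i, false) s = m)%N.
  by apply: double_inj; rewrite -disp0_size.
have lt_c i : (count_mem (i, false) s < m.+1)%N.
  by rewrite ltnS -sum_s (bigD1 i) //= leq_addr.
pose c : T := [ffun i => Ordinal (lt_c i)].
rewrite (bigD1 c) /=; last first.
  by rewrite -[X in _ == X]sum_s; apply/eqP; apply: eq_bigr => i _; rewrite ffunE.
have -> : [forall a : dir, count_mem a s == c a.1].
  by apply/forallP => -[i [|]]; rewrite ffunE //= disp0_count.
by rewrite lerDl sumr_ge0.
Qed.

End Return.

Section BetaBound.
Variables (R : realType) (d : nat).
Hypothesis d_gt0 : (0 < d)%N.
Local Notation beta := (beta R d).

Lemma beta_ge0 m : 0 <= beta m.
Proof. by rewrite ltW ?beta_gt0. Qed.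

Lemma beta_nincr m k : (m <= k)%N -> beta k <= beta m.
Proof.
move=> /subnK <-; elim: (k - m)%N => [|j IHj] //.
rewrite addSn betaS; apply: le_trans IHj; rewrite ler_piMr ?beta_ge0 //.
by rewrite ler_pdivrMr ?mul1r ?ler_nat ?ltr0n ?muln_gt0 ?d_gt0 // mulnC; exact: ltn_ceil.
Qed.

Lemma beta_small m : (m <= d)%N -> beta m = m`!%:R / d%:R ^+ m.
Proof.
have d_neq0 : d%:R != 0 :> R by rewrite pnatr_eq0 -lt0n.
elim: m => [|m IHm] lt_md; first by rewrite /beta big_ord0 divr1.
rewrite betaS IHm; last exact: ltnW.
rewrite divn_small // muln1 factS natrM exprS.
by rewrite mulrC invfM mulrACA.
Qed.

(** In the first half of the block of factors t = qd, ..., qd + d - 1 each factor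
is at most 1 - 1 / (2(q + 1)), whose square is at most (q + 1) / (q + 2).  Six
factors give a cube, which makes [beta] decay like the inverse cube of its
argument. *)
Lemma beta_block q : (12 <= d)%N ->
  beta (q.+1 * d) <= beta (q * d) * (q.+1%:R / q.+2%:R) ^+ 3.
Proof.
move=> d_big; pose r : R := 1 - (2 * q.+1%:R)^-1.
have q_gt0 : 0 < q.+1%:R :> R by [].
have r_ge0 : 0 <= r.
  by rewrite subr_ge0 invf_le1 ?mulr_gt0 // -natrM ler1n; lia.
have steps j : (j <= 6)%N -> beta (q * d + j) <= beta (q * d) * r ^+ j.
  elim: j => [|j IHj] lt_j6; first by rewrite addn0 expr0 mulr1.
  rewrite addnS betaS exprSr mulrA; apply: ler_pM (IHj (ltnW lt_j6)) _.
  - exact: beta_ge0.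
  - by rewrite divr_ge0 ?ler0n.
  have -> : ((q * d + j) %/ d = q)%N by rewrite divnMDl // divn_small ?addn0 //; lia.
  rewrite ler_pdivrMr ?ltr0n ?muln_gt0 ?d_gt0 // /r natrM.
  have -> : (1 - (2 * q.+1%:R)^-1) * (d%:R * q.+1%:R) = d%:R * q.+1%:R - d%:R / 2 :> R.
    by field; rewrite ?nat1r ?lt0r_neq0.
  rewrite lerBrDr -(ler_pM2r (_ : 0 < 2)) // mulrDl divfK // -!natrM -natrD ler_nat.
  by nia.
have r2 : r ^+ 2 <= q.+1%:R / q.+2%:R.
  rewrite ler_pdivlMr // /r -[q.+2%:R]nat1r; set x := q.+1%:R.
  have x_ge1 : 1 <= x by rewrite ler1n.
  have -> : (1 - (2 * x)^-1) ^+ 2 * (1 + x) = x - (3 * x - 1) / (4 * x ^+ 2).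
    by field; rewrite lt0r_neq0 //; lra.
  by rewrite lerBlDr lerDl divr_ge0 ?mulr_ge0 ?sqr_ge0 //; lra.
apply: le_trans (beta_nincr (_ : q * d + 6 <= _)%N) _; first lia.
apply: le_trans (steps 6 _) _ => //; apply: ler_wpM2l; first exact: beta_ge0.
have -> : r ^+ 6 = (r ^+ 2) ^+ 3 by rewrite -exprM.
by rewrite lerXn2r ?nnegrE ?sqr_ge0 ?divr_ge0.
Qed.

Lemma beta_blocks q : (12 <= d)%N -> beta (q.+1 * d) <= beta d * (8 / q.+2%:R ^+ 3).
Proof.
move=> d_big; elim: q => [|q IHq]; first by rewrite mul1n -natrX divff ?mulr1 ?pnatr_eq0.
apply: le_trans (beta_block _ d_big) _.
apply: le_trans (ler_wpM2r _ IHq) _; first by rewrite exprn_ge0 ?divr_ge0.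
rewrite le_eqVlt; apply/orP; left; apply/eqP; field.
by apply/andP; split; rewrite ?(nat1r, natr1) ?pnatr_eq0.
Qed.

(** The cubic decay is what makes the sum of m * [beta m] converge.  The factor
1/d comes from [beta 1] for m < 4, and is left over from [beta 4] = 24 / d^4
once d^3 has been spent on m^3 for larger m. *)
Lemma beta_ub m : (12 <= d)%N -> (0 < m)%N -> beta m <= 192 / (d%:R * m%:R ^+ 3).
Proof.
move=> d_big m_gt0.
have D_gt0 : 0 < d%:R :> R by rewrite ltr0n.
have M_gt0 : 0 < m%:R :> R by rewrite ltr0n.
have den_gt0 : 0 < d%:R * m%:R ^+ 3 :> R by rewrite mulr_gt0 ?exprn_gt0.
rewrite ler_pdivlMr //.
have b4 : beta 4 = 24 / d%:R ^+ 4 by rewrite beta_small //; lia.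
have [m_lt4|m_ge4] := ltnP m 4.
  apply: le_trans (ler_wpM2r (ltW den_gt0) (beta_nincr m_gt0)) _.
  rewrite beta_small //= expr1 mulrA divfK ?lt0r_neq0 // mul1r -natrX ler_nat.
  by case: m m_lt4 {m_gt0 M_gt0 den_gt0} => [|[|[|[]]]].
have [m_ltd|m_ged] := ltnP m d.
  apply: le_trans (ler_wpM2r (ltW den_gt0) (beta_nincr m_ge4)) _.
  rewrite b4 mulrAC ler_pdivrMr ?exprn_gt0 //.
  apply: (le_trans (y := 24 * d%:R ^+ 4)).
    rewrite ler_pM2l // [d%:R ^+ 4]exprS ler_pM2l // lerXn2r ?nnegrE ?ler0n // ler_nat; exact: ltnW.
  by rewrite ler_wpM2r ?exprn_ge0 ?ler0n // ler_nat.
have q_gt0 : (0 < m %/ d)%N by rewrite divn_gt0.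
have m_ge : ((m %/ d).-1.+1 * d <= m)%N by rewrite prednK // leq_trunc_div.
have m_lt : (m <= (m %/ d).-1.+2 * d)%N by rewrite prednK // ltnW // ltn_ceil.
set q := (m %/ d).-1 in m_ge m_lt.
apply: le_trans (ler_wpM2r (ltW den_gt0) (beta_nincr m_ge)) _.
apply: le_trans (ler_wpM2r (ltW den_gt0) (beta_blocks q d_big)) _.
apply: (le_trans (y := beta 4 * (8 / q.+2%:R ^+ 3) * (d%:R * (q.+2 * d)%:R ^+ 3))).
  apply: ler_pM; rewrite ?mulr_ge0 ?exprn_ge0 ?invr_ge0 ?exprn_ge0 ?beta_ge0 //.
    by rewrite ler_wpM2r ?divr_ge0 ?exprn_ge0 // beta_nincr //; lia.
  by rewrite ler_pM2l // lerXn2r ?nnegrE ?ler_nat.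
rewrite b4 natrM le_eqVlt; apply/orP; left; apply/eqP; field.
by rewrite -natrD !pnatr_eq0 -!lt0n d_gt0.
Qed.

(** Only even lengths contribute, and the sum of 1/m^2 over 1 <= m < n is at most
2 - 2/n. *)
Lemma sum_return_prob N : (12 <= d)%N ->
  \sum_(l < N) l%:R * return_prob R d l <= 4 * (192 / d%:R).
Proof.
move=> d_big; pose f l := l%:R * return_prob R d l.
have f_ge0 l : 0 <= f l by rewrite mulr_ge0 // mean_ge0 // => s _; rewrite ler0n.
have return_ub m : (0 < m)%N -> return_prob R d m.*2 <= 192 / d%:R / m%:R ^+ 3.
  move=> m_gt0; rewrite -mulrA -invfM.
  exact: le_trans (return_prob_even R d_gt0 _) (beta_ub d_big m_gt0).
have K_ge0 : 0 <= 192 / d%:R :> R by apply: divr_ge0; exact: ler0n.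
move: return_ub K_ge0; move: (192 / d%:R) => K return_ub K_ge0.
apply: (le_trans (y := \sum_(l < N.+1.*2) f l)).
  have le_N : (N <= N.+1.*2)%N by lia.
  by rewrite -(subnKC le_N) big_split_ord /= lerDl sumr_ge0.
have -> : \sum_(l < N.+1.*2) f l = \sum_(m < N.+1) f m.*2.
  elim: N.+1 => [|j IHj]; first by rewrite !big_ord0.
  rewrite doubleS !big_ord_recr /= IHj [f (_.+1)]/f return_prob_odd ?mulr0 ?addr0 //.
  by rewrite /= odd_double.
apply: (le_trans (y := 2 * K * (2 - 2 / N.+1%:R))); last first.
  rewrite mulrBr lerBlDr -[leLHS]addr0; apply: lerD.
    by rewrite le_eqVlt; apply/orP; left; apply/eqP; ring.
  by apply: mulr_ge0; [apply: mulr_ge0|apply: divr_ge0].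
elim: N => [|N IHN]; first by rewrite big_ord1 /f /= mul0r divr1 subrr mulr0.
rewrite big_ord_recr /=; apply: le_trans (lerD IHN _) _.
  by rewrite /f; apply: ler_wpM2l (return_ub _ _); first exact: ler0n.
rewrite -[N.+1.*2]muln2 natrM -[N.+2%:R]natr1; set x := N.+1%:R.
have x_gt0 : 0 < x by rewrite ltr0n.
rewrite -subr_ge0.
have -> : 2 * K * (2 - 2 / (x + 1)) - (2 * K * (2 - 2 / x) + x * 2 * (K / x ^+ 3))
   = 2 * K * ((x - 1) / (x ^+ 2 * (x + 1))).
  by field; rewrite !lt0r_neq0 // addr_gt0.
apply: mulr_ge0; first exact: mulr_ge0.
apply: divr_ge0; first by rewrite subr_ge0 ler1n.
by rewrite mulr_ge0 ?exprn_ge0 ?addr_ge0 ?ler0n.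
Qed.

End BetaBound.

(** * Most steps are cuts, at all times *)
Section Maximal.

Definition heavy_start (z : seq bool) : bool :=
  has (fun i => i <= (count id (take i z)).*2)%N (iota 1 (size z)).

Lemma heavy_startP z :
  reflect (exists i, [/\ 0 < i, i <= size z & i <= (count id (take i z)).*2]%N)
          (heavy_start z).
Proof.
apply: (iffP hasP) => [[i]|[i [i_gt0 le_iz le_i]]].
  by rewrite mem_iota add1n ltnS => /andP[i_gt0 le_iz] le_i; exists i.
by exists i; rewrite // mem_iota add1n ltnS i_gt0.
Qed.

(** The one-sided maximal inequality of Hardy and Littlewood for masks.  Read from
the left, a prefix of length i that witnesses heaviness contains at most i heavy
starting points, and they are paid for by the true entries of that prefix; then
one continues behind it. *)
Lemma maximal_ineq z :
  (\sum_(0 <= a < size z) heavy_start (drop a z) <= (count id z).*2)%N.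
Proof.
have [n] := ubnP (size z); elim: n z => [|n IHn] z; first by [].
rewrite ltnS => le_zn.
have [heavy|light] := boolP (heavy_start z).
  have /heavy_startP[i [i_gt0 le_iz le_i]] := heavy.
  rewrite (big_cat_nat (n := i)) //=.
  have -> : count id z = (count id (take i z) + count id (drop i z))%N.
    by rewrite -count_cat cat_take_drop.
  rewrite doubleD.
  apply: leq_add.
    apply: leq_trans le_i; apply: leq_trans (_ : \sum_(0 <= a < i) 1 <= _)%N.
      by apply: leq_sum => a _; exact: leq_b1.
    by rewrite sum_nat_const_nat muln1 subn0.
  apply: leq_trans (IHn _ _); last by rewrite size_drop; lia.
  rewrite size_drop -{1}[i]add0n big_addn; apply: leq_sum => a _.
  by rewrite drop_drop.
case: z light le_zn => [|b z] light le_zn; first by rewrite big_nil.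
rewrite big_nat_recl //= (negPf light) add0n.
by apply: leq_trans (IHn z _) _ => //; rewrite leq_double leq_addl.
Qed.

End Maximal.

Section Crossed.
Variables (R : realType) (d : nat).
Local Notation dir := (direction d).

(** Step [k] of a walk leads from the k-th to the (k+1)-st position.  When it is not
crossed, the positions up to [k] and the positions after [k] are disjoint, and the
step is a cut edge of the trace. *)
Definition crossed (s : seq dir) (k : nat) : bool :=
  [exists i : 'I_(size s), exists l : 'I_(size s).+1,
    [&& i <= k, k < i + l, i + l <= size s & disp (take l (drop i s)) == 0%R]%N].

Lemma crossedP s k :
  reflect (exists i l, [/\ i <= k, k < i + l, i + l <= size s
                         & disp (take l (drop i s)) = 0%R]%N)
          (crossed s k).
Proof.
apply: (iffP existsP) => [[i /existsP[l /and4P[ik kl ls /eqP s0]]]|[i [l [ik kl ls s0]]]].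
  by exists i, l.
have lt_i : (i < size s)%N by lia.
have lt_l : (l < (size s).+1)%N by lia.
exists (Ordinal lt_i); apply/existsP; exists (Ordinal lt_l) => /=.
by rewrite ik kl ls s0 eqxx.
Qed.

Definition crossings s := mkseq (crossed s) (size s).

Lemma crossed_window s a n k : (a + n <= size s)%N ->
  crossed (take n (drop a s)) k -> crossed s (a + k).
Proof.
move=> le_an /crossedP[i [l []]]; rewrite size_takel ?size_drop; last by lia.
move=> ik kl ls s0; apply/crossedP; exists (a + i)%N, l; split; try lia.
have E : n = (i + (n - i))%N by lia.
move: s0; rewrite E addnC -take_drop take_takel ?drop_drop 1?addnC //; lia.
Qed.

Lemma count_mkseq f n : (count id (mkseq f n) = \sum_(k < n) f k)%N.
Proof.
rewrite -sum1_count big_map big_mkcond -{1}[n]subn0 -/(index_iota 0 n) big_mkord.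
by apply: eq_bigr => k _ /=; case: f.
Qed.

(** A closed piece of a window is a closed piece of the whole walk. *)
Lemma heavy_window s a n : (a + n <= size s)%N ->
  heavy_start (crossings (take n (drop a s))) -> heavy_start (drop a (crossings s)).
Proof.
move=> le_an; have sz : size (take n (drop a s)) = n.
  by rewrite size_takel // size_drop; lia.
case/heavy_startP => i []; rewrite size_mkseq sz => i_gt0 le_in le_i.
apply/heavy_startP; exists i; split; rewrite // ?size_drop ?size_mkseq; first by lia.
apply: leq_trans le_i _; rewrite leq_double.
have takeE f m : (i <= m)%N -> take i (mkseq f m) = mkseq f i.
  by move=> le_im; rewrite /mkseq -map_take take_iota (minn_idPl le_im).
rewrite /crossings sz takeE // count_mkseq.
have -> : take i (drop a (mkseq (crossed s) (size s))) = mkseq (fun k => crossed s (a + k)) i.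
  rewrite /mkseq -map_drop drop_iota -map_take take_iota add0n (minn_idPl _); last by lia.
  by rewrite -[a in iota a]addn0 iotaDl -map_comp.
rewrite count_mkseq; apply: leq_sum => k _.
by have := @crossed_window s a n k le_an; case: crossed => // ->.
Qed.

(** A closed piece of length [l] runs over [l] steps. *)
Lemma count_crossings s : (count id (crossings s) <=
  \sum_(i < size s) \sum_(l < (size s).+1)
     l * ((i + l <= size s) && (disp (take l (drop i s)) == 0%R)))%N.
Proof.
set N := size s; rewrite count_mkseq.
apply: (@leq_trans (\sum_(k < N) \sum_(i < N) \sum_(l < N.+1)
    (i <= k < i + l) * ((i + l <= N) && (disp (take l (drop i s)) == 0%R)))%N).
  apply: leq_sum => k _; case: (boolP (crossed s k)) => // /existsP[i /existsP[l]].
  case/and4P=> ik kl ls s0.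
  by rewrite (bigD1 i) //= (bigD1 l) //= ik kl ls s0.
rewrite exchange_big /=; apply: leq_sum => i _.
rewrite exchange_big /=; apply: leq_sum => l _.
rewrite -big_distrl /= leq_mul2r; apply/orP; right.
have -> : (\sum_(k < N) (i <= k < i + l) = minn (N - i) l)%N; last exact: geq_minr.
elim: N {i l} (nat_of_ord i) (nat_of_ord l) => [|n IHn] i l; first by rewrite big_ord0; lia.
rewrite big_ord_recr /= IHn; lia.
Qed.

(** Crossings are correlated over all distances, so the maximal inequality replaces
any use of independence.  It needs stationarity: a walk of length [n] is seen as
each of [n] windows of a walk of length [2n], and the expected number of heavy
starting points in the long walk is at most twice its expected number of crossed
steps. *)
Lemma heavy_prob n : (12 <= d)%N ->
  mean n (fun s => (heavy_start (crossings s))%:R) <= 4 * (4 * (192 / d%:R)) :> R.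
Proof.
move=> d_big; have K_ge0 : 0 <= 4 * (4 * (192 / d%:R)) :> R.
  by do 2!apply: mulr_ge0 => //; apply: divr_ge0; exact: ler0n.
have [->|n_gt0] := posnP n.
  by have -> : mean 0 (fun s => (heavy_start (crossings s))%:R) = 0 :> R.
move: K_ge0; set K := 4 * (192 / d%:R) => _.
have d_gt0 : (0 < d)%N by lia.
have dir_gt0 : (0 < #|{: dir}|)%N by rewrite card_prod card_ord card_bool; lia.
set p := mean _ _; rewrite -(ler_pM2l (_ : 0 < n%:R)) ?ltr0n //.
pose F (s : seq dir) : R := \sum_(i < n + n) \sum_(l < (n + n).+1)
     l%:R * ((i + l <= n + n)%N && (disp (take l (drop i s)) == 0%R))%:R.
have -> : n%:R * p = \sum_(0 <= a < n) p by rewrite sumr_const_nat subn0 mulr_natl.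
apply: (@le_trans _ _ (mean (n + n) (fun s => 2 * F s))).
  rewrite big_nat_cond.
  rewrite (eq_bigr (fun a => mean (n + n) (fun s =>
      (heavy_start (crossings (take n (drop a s))))%:R : R))); last first.
    move=> a lt_an.
    by rewrite (mean_window dir_gt0 (fun s => (heavy_start (crossings s))%:R)) //; lia.
  rewrite -mean_sum; apply: ler_mean => s sz_s.
  apply: (@le_trans _ _ (count id (crossings s)).*2%:R).
    apply: le_trans (_ : (\sum_(0 <= a < size (crossings s))
          heavy_start (drop a (crossings s)))%:R <= _); last by rewrite ler_nat maximal_ineq.
    rewrite size_mkseq sz_s [X in _ <= X%:R](big_cat_nat (n := n)) ?leq_addr //=.
    rewrite natrD natr_sum.
    apply: le_trans (_ : _ <= \sum_(0 <= a < n) (heavy_start (drop a (crossings s)))%:R) _.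
      rewrite [leRHS]big_nat_cond; apply: ler_sum => a lt_an; rewrite ler_nat.
      have := @heavy_window s a n; rewrite sz_s; case: heavy_start => // -> //; lia.
    by rewrite lerDl ler0n.
  rewrite -muln2 natrM mulrC ler_wpM2l // /F.
  apply: le_trans (_ : _ <= (\sum_(i < size s) \sum_(l < (size s).+1)
     l * ((i + l <= size s) && (disp (take l (drop i s)) == 0%R)))%:R) _.
    by rewrite ler_nat count_crossings.
  rewrite sz_s natr_sum; apply: ler_sum => i _; rewrite natr_sum; apply: ler_sum => l _.
  by rewrite natrM.
rewrite meanZ mean_sum.
apply: (@le_trans _ _ (2 * \sum_(i < n + n) K)); last first.
  rewrite sumr_const card_ord -(mulr_natl K) natrD.
  by rewrite le_eqVlt; apply/orP; left; apply/eqP; ring.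
rewrite ler_wpM2l //; apply: ler_sum => i _.
apply: le_trans (sum_return_prob _ d_gt0 (n + n).+1 d_big).
rewrite mean_sum; apply: ler_sum => l _; rewrite meanZ ler_wpM2l //.
have [le_il|_] := leqP (i + l) (n + n).
  by rewrite /return_prob -(mean_window dir_gt0 _ le_il).
by rewrite /= mean0 mean_ge0 // => s _; rewrite ler0n.
Qed.

End Crossed.

(** * Distances in a graph *)
Section GraphDistance.
Variables (d : nat) (G : egraph d).

Lemma gadj_sym : symmetric (@gadj d G).
Proof. by move=> x y; rewrite /gadj fsetUC. Qed.

Lemma uniq_path_size (x : gV G) p : uniq (x :: p) -> (size p < #|` gV G|)%N.
Proof.
move=> uniq_p; rewrite cardfE cardE; apply: (uniq_leq_size uniq_p) => y _.
by rewrite mem_enum.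
Qed.

Lemma gdist_le x p : path (@gadj d G) x p -> (gdist x (last x p) <= size p)%N.
Proof.
case/shortenP => p' path_p' uniq_p' sub_p'.
have /andP[_ /uniq_leq_size/(_ sub_p')] := uniq_p'; apply: leq_trans.
rewrite leqNgt; apply/negP => lt_size.
have lt_p' := uniq_path_size uniq_p'.
have := before_find 0%N lt_size; rewrite nth_iota // add0n => /existsP[].
by exists (in_tuple p'); rewrite /gpath path_p' uniq_p' eqxx.
Qed.

Lemma gdist_path x p : path (@gadj d G) x p ->
  exists q : seq (gV G), [/\ gpath x q, last x q = last x p & size q = gdist x (last x p)].
Proof.
case/shortenP => p' path_p' uniq_p' _; set N := #|` gV G|.
pose P k := [exists q : k.-tuple (gV G), gpath x q && (last x q == last x p')].
have lt_p' : (size p' < N)%N := uniq_path_size uniq_p'.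
have hasP : has P (iota 0 N).
  apply/hasP; exists (size p'); rewrite ?mem_iota //.
  by apply/existsP; exists (in_tuple p'); rewrite /gpath path_p' uniq_p' eqxx.
have /existsP[q /andP[q_path /eqP q_last]] := nth_find 0%N hasP.
exists q; split; rewrite // size_tuple nth_iota // -[X in (_ < X)%N](size_iota 0 N).
by rewrite -has_find.
Qed.

Lemma path_rev x p : path (@gadj d G) x p ->
  exists r, [/\ path (@gadj d G) (last x p) r, last (last x p) r = x & size r = size p].
Proof.
move=> path_p; exists (rev (belast x p)); split; last by rewrite size_rev size_belast.
  by rewrite rev_path (eq_path (e' := @gadj d G)) // => y z; rewrite gadj_sym.
by case: (p) => //= y p'; rewrite rev_cons last_rcons.
Qed.

Lemma gdist_sym_le x p : path (@gadj d G) x p -> (gdist (last x p) x <= size p)%N.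
Proof.
by case/path_rev => r [r_path r_last <-]; rewrite -{2}r_last; exact: gdist_le.
Qed.

Lemma gdist_le_diam (x y : gV G) : (gdist x y <= gdiam G)%N.
Proof.
apply: leq_trans (leq_bigmax (F := fun x : gV G => \max_(y : gV G) @gdist d G x y) x).
exact: (leq_bigmax (F := @gdist d G x)).
Qed.

End GraphDistance.

(** * The source is an end of every diametrical path *)
Section TraceGeometry.
Variables (d n : nat) (v : 'rV[int]_d) (s : n.-tuple (direction d)).
Local Notation G := (trace v s).
Local Notation X := (position v s).

Lemma positionE i : (i <= n)%N -> X i = v + disp (take i s).
Proof.
elim: i => [|i IHi] lt_in.
  by rewrite /position take0 disp_nil big_pred0.
rewrite (positionS v s (Ordinal lt_in)) /= IHi ?(ltnW lt_in) //.
have a : direction d := tnth s (Ordinal lt_in).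
rewrite (take_nth a) ?size_tuple // -cats1 disp_cat disp_cons disp_nil addr0 addrA.
by rewrite (tnth_nth a).
Qed.

Lemma position_in_trace i : X (minn i n) \in gV G.
Proof.
have lt_i : (minn i n < n.+1)%N by rewrite ltnS geq_minr.
by apply/imfsetP; exists (Ordinal lt_i).
Qed.

(** Times after [n] are truncated, which spares a proof that [i] is at most [n]. *)
Definition visit i : gV G := [` position_in_trace i]%fset.

Lemma val_visit i : (i <= n)%N -> val (visit i) = X i.
Proof. by move=> le_in; rewrite /= (minn_idPl le_in). Qed.

Lemma visitP (x : gV G) : exists2 i, (i <= n)%N & x = visit i.
Proof.
have /imfsetP[i _ xE] := valP x; have le_in : (i <= n)%N by rewrite -ltnS.
by exists i => //; apply: val_inj; rewrite val_visit // xE.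
Qed.

Lemma fset2_eq (K : choiceType) (x y z t : K) : [fset x; y]%fset = [fset z; t]%fset ->
  (x = z /\ y = t) \/ (x = t /\ y = z).
Proof.
move=> eq_s.
have : x \in [fset z; t]%fset by rewrite -eq_s fset21.
have : y \in [fset z; t]%fset by rewrite -eq_s fset22.
have : z \in [fset x; y]%fset by rewrite eq_s fset21.
have : t \in [fset x; y]%fset by rewrite eq_s fset22.
move=> /fset2P[] -> /fset2P[] -> /fset2P[] ? /fset2P[] ?; subst; tauto.
Qed.

Lemma visit_adj i : (i < n)%N -> gadj (visit i) (visit i.+1).
Proof.
by move=> lt_in; rewrite /gadj !val_visit ?(ltnW lt_in) //; apply/imfsetP; exists (Ordinal lt_in).
Qed.

Lemma gadjP (x y : gV G) : gadj x y -> exists2 i, (i < n)%N &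
  (x = visit i /\ y = visit i.+1) \/ (x = visit i.+1 /\ y = visit i).
Proof.
move=> /imfsetP[i _ /fset2_eq eq_xy]; exists i => //.
have le_in := ltnW (ltn_ord i).
by case: eq_xy => -[xE yE]; [left|right]; split; apply: val_inj; rewrite val_visit.
Qed.

Lemma visit_path i j : (i <= j <= n)%N ->
  exists p, [/\ path (@gadj d G) (visit i) p, last (visit i) p = visit j & size p = (j - i)%N].
Proof.
elim: j => [|j IHj] /andP[le_ij le_jn].
  by exists [::]; split; rewrite //=; congr visit; lia.
move: le_ij; rewrite leq_eqVlt => /predU1P[->|le_ij].
  by exists [::]; rewrite subnn.
have [|p [p_path p_last p_size]] := IHj; first by rewrite -ltnS le_ij ltnW.
exists (rcons p (visit j.+1)); split; rewrite ?last_rcons ?size_rcons ?p_size ?subSn //.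
by rewrite rcons_path p_path p_last visit_adj.
Qed.

Definition cuts i := count (fun k => ~~ crossed s k) (iota 0 i).

Lemma cutsS i : cuts i.+1 = (cuts i + ~~ crossed s i)%N.
Proof. by rewrite /cuts -addn1 iotaD count_cat /= addn0. Qed.

Lemma cuts_homo : {homo cuts : i j / (i <= j)%N}.
Proof. by apply: homo_leq => // [i j k|i]; [exact: leq_trans|rewrite cutsS leq_addr]. Qed.

Lemma cuts_le i : (cuts i <= i)%N.
Proof. by apply: leq_trans (count_size _ _) _; rewrite size_iota. Qed.

(** Between two visits to the same vertex all steps are crossed. *)
Lemma cuts_visit i j : (i <= n)%N -> (j <= n)%N -> visit i = visit j -> cuts i = cuts j.
Proof.
wlog le_ij : i j / (i <= j)%N.
  by move=> hw; case/orP: (leq_total i j) => le_ij iN jN eq_ij; [|symmetry]; apply: hw.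
move=> iN jN /(congr1 val); rewrite !val_visit // !positionE // => /addrI eq_ij.
have loop0 : disp (take (j - i) (drop i s)) = 0.
  move: eq_ij; have -> : take j s = take i s ++ take (j - i) (drop i s).
    rewrite -{1}[tval s](cat_take_drop i) take_cat size_takel ?size_tuple //.
    by rewrite ltnNge le_ij.
  by rewrite disp_cat -[LHS]addr0 => /addrI.
suff cutsD m : (i + m <= j)%N -> cuts (i + m) = cuts i by rewrite -(cutsD (j - i)%N) subnKC.
elim: m => [|m IHm] le_mj; first by rewrite addn0.
rewrite addnS cutsS IHm; last by lia.
suff -> : crossed s (i + m) by rewrite addn0.
by apply/crossedP; exists i, (j - i)%N; rewrite size_tuple; split => //; lia.
Qed.

(** The number of cuts that separate [x] from the source, read off at the first
visit to [x]; by [cuts_visit] every other visit gives the same number. *)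
Definition level (x : gV G) : nat := cuts (index x (mkseq visit n.+1)).

Lemma level_visit i : (i <= n)%N -> level (visit i) = cuts i.
Proof.
move=> le_in; have in_s : visit i \in mkseq visit n.+1.
  by apply: map_f; rewrite mem_iota ltnS le_in.
have lt_ind : (index (visit i) (mkseq visit n.+1) < n.+1)%N.
  by rewrite -[X in (_ < X)%N](size_mkseq visit) index_mem.
apply: cuts_visit => //.
by rewrite -[visit (index _ _)](nth_mkseq (visit 0) visit lt_ind) nth_index.
Qed.

(** Along the walk the level is nondecreasing and grows by one at each cut, so an
edge of the trace that raises the level is a cut traversed forwards. *)
Lemma level_edge (x y : gV G) : gadj x y -> (level x < level y)%N ->
  exists k, [/\ (k < n)%N, ~~ crossed s k, level x = cuts k & y = visit k.+1].
Proof.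
case/gadjP => k lt_kn [] [-> ->]; rewrite !level_visit ?(ltnW lt_kn) // => lt_xy.
  by exists k; split => //; move: lt_xy; rewrite cutsS; case: crossed; rewrite ?addn0 ?ltnn.
by move: lt_xy; rewrite ltnNge cuts_homo.
Qed.

Lemma cut_inj j k : ~~ crossed s j -> ~~ crossed s k -> cuts j = cuts k -> j = k.
Proof.
wlog lt_jk : j k / (j < k)%N => [hw|] cut_j cut_k eq_c.
  by case: (ltngtP j k) => // [lt_jk|lt_kj]; [|symmetry]; apply: hw.
by have := cuts_homo lt_jk; rewrite cutsS cut_j eq_c addn1 ltnn.
Qed.

(** The level grows by at most one per edge, and only the cut [k] leads from level
[cuts k] to the next one. *)
Lemma path_through_cut k (x : gV G) p : (k < n)%N -> ~~ crossed s k ->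
  path (@gadj d G) x p -> (level x <= cuts k)%N -> (cuts k < level (last x p))%N ->
  exists p1 p2, [/\ p = p1 ++ p2, last x p1 = visit k.+1 & (cuts k < level x + size p1)%N].
Proof.
move=> lt_kn cut_k; elim: p x => [|y p IHp] x /=; first by lia.
case/andP=> adj_xy path_p le_x lt_last.
have step_xy : (level y <= (level x).+1)%N.
  have [le_yx|lt_xy] := leqP (level y) (level x); first exact: leqW.
  have [j [lt_jn cut_j -> ->]] := level_edge adj_xy lt_xy.
  by rewrite level_visit // cutsS cut_j addn1.
have [le_y|lt_y] := leqP (level y) (cuts k).
  have [p1 [p2 [-> p1_last p1_size]]] := IHp y path_p le_y lt_last.
  have lt_x : (cuts k < level x + size (y :: p1))%N.
    by rewrite addnS -addSn; apply: leq_trans p1_size (leq_add step_xy (leqnn _)).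
  by exists (y :: p1), p2; split.
have lt_xy : (level x < level y)%N by lia.
have [j [lt_jn cut_j x_lev y_j]] := level_edge adj_xy lt_xy.
exists [:: y], p; split => //=; last by lia.
rewrite y_j; congr (visit _.+1); apply: cut_inj => //; lia.
Qed.

Lemma last_cut i : (0 < cuts i)%N ->
  exists k, [/\ (k < i)%N, ~~ crossed s k & cuts i = (cuts k).+1].
Proof.
elim: i => [|i IHi] //; rewrite cutsS; case: (boolP (crossed s i)) => [_|cut_i] /=.
  by rewrite addn0 => /IHi[k [lt_ki cut_k ->]]; exists k; split=> //; exact: ltnW.
by exists i; rewrite cut_i addn1.
Qed.

Hypothesis light : ~~ heavy_start (crossings s).

Lemma cuts_majority i : (0 < i <= n)%N -> (i < (cuts i).*2)%N.
Proof.
case/andP=> i_gt0 le_in.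
have eq_i : (count (crossed s) (iota 0 i) + cuts i = i)%N.
  by rewrite -[RHS](size_iota 0 i) -(count_predC (crossed s)).
move: light; apply: contraNltn => le_c; apply/heavy_startP; exists i.
rewrite size_mkseq size_tuple; split=> //.
rewrite /crossings /mkseq -map_take take_iota size_tuple (minn_idPl le_in) count_map.
have -> : count (preim (crossed s) id) (iota 0 i) = count (crossed s) (iota 0 i) by [].
lia.
Qed.

(** Let [k] be the last cut before time [i].  A geodesic from the source to the j-th
position reaches position k+1 after at least [cuts i] edges, while the walk itself
joins position k+1 to position i in i - (k+1) steps.  Since [k.+1] is at least
[cuts i], and [i] is less than twice [cuts i], replacing the first part of the
geodesic by this piece of the walk makes it shorter. *)
Lemma start_is_farther i j : (0 < i)%N -> (i <= j <= n)%N ->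
  exists p, [/\ path (@gadj d G) (visit i) p, last (visit i) p = visit j
    & (size p < gdist (visit 0) (visit j))%N].
Proof.
move=> i_gt0 /andP[le_ij le_jn].
have major : (i < (cuts i).*2)%N by apply: cuts_majority; rewrite i_gt0; lia.
have [|k [lt_ki cut_k ci]] := @last_cut i; first by lia.
have [|p0 [p0_path p0_last _]] := @visit_path 0 j; first by rewrite le_jn.
have [p []] := gdist_path p0_path; rewrite p0_last => /andP[p_path _] p_last <-.
have lev0 : level (visit 0) = 0%N by rewrite level_visit.
have [|||p1 [p2 [pE p1_last p1_size]]] := @path_through_cut k (visit 0) p _ cut_k p_path.
- by lia.
- by rewrite lev0.
- by rewrite p_last level_visit // -ltnS -ci ltnS cuts_homo.
have [|r [r_path r_last r_size]] := @visit_path k.+1 i; first by rewrite lt_ki; lia.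
(* The new path follows the walk backwards from [i] to [k.+1], then the geodesic. *)
have [r' []] := path_rev r_path; rewrite r_last r_size => r'_path r'_last r'_size.
exists (r' ++ p2); split.
- rewrite cat_path r'_path r'_last -p1_last.
  by move: p_path; rewrite pE cat_path => /andP[].
- by rewrite last_cat r'_last -p1_last -last_cat -pE.
- by rewrite pE !size_cat r'_size; have := cuts_le k; lia.
Qed.

Lemma diametrical_start q : q \in diametrical G ->
  val q.1 = v \/ val (last q.1 q.2) = v.
Proof.
rewrite inE => /andP[_ /eqP diam_q].
have val0 : val (visit 0) = v.
  by rewrite val_visit // positionE // take0 disp_nil addr0.
have [i le_in q1] := visitP q.1; have [j le_jn q2] := visitP (last q.1 q.2).
move: diam_q; rewrite q2 q1.
have [->|i_gt0] := posnP i; first by left.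
have [->|j_gt0] := posnP j; first by right.
move=> diam_q; exfalso; have [le_ij|lt_ji] := leqP i j.
  have [|p [p_path p_last lt_p]] := start_is_farther i_gt0 (j := j); first by rewrite le_ij.
  have := gdist_le p_path; rewrite p_last diam_q.
  by have := gdist_le_diam (visit 0) (visit j); lia.
have [|p [p_path p_last lt_p]] := start_is_farther j_gt0 (j := i); first by rewrite ltnW.
have := gdist_sym_le p_path; rewrite p_last diam_q.
by have := gdist_le_diam (visit 0) (visit i); lia.
Qed.

End TraceGeometry.

(** * The diametrical path estimator *)
Section PsiBounds.
Variables (R : realType) (d n : nat) (v : 'rV[int]_d) (s : n.-tuple (direction d)).
Local Notation G := (trace v s).

Lemma diametrical_neq0 : (0 < #|diametrical G|)%N.
Proof.
have V_gt0 : (0 < #|{: gV G}|)%N by apply/card_gt0P; exists (visit v s 0).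
have [x xE] := bigop.eq_bigmax (fun x : gV G => \max_(y : gV G) @gdist d G x y) V_gt0.
have [y yE] := bigop.eq_bigmax (@gdist d G x) V_gt0.
have diam_xy : gdist x y = gdiam G by rewrite /gdiam xE yE.
have [p p_path p_last] : exists2 p, path (@gadj d G) x p & last x p = y.
  have [i le_in ->] := visitP x; have [j le_jn ->] := visitP y.
  have [|p [p_path p_last _]] := @visit_path d n v s 0 i; first by rewrite le_in.
  have [|r [r_path r_last _]] := @visit_path d n v s 0 j; first by rewrite le_jn.
  have [p' []] := path_rev p_path; rewrite p_last => p'_path p'_last _.
  by exists (p' ++ r); rewrite ?cat_path ?last_cat p'_last // p'_path r_path.
have [q [q_path q_last q_size]] := gdist_path p_path.
rewrite p_last diam_xy in q_size q_last.
have /eqP q_sz := q_size.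
apply/card_gt0P; exists (x, Tuple q_sz); rewrite inE /= q_path q_last.
by rewrite diam_xy eqxx.
Qed.

Lemma Psi_ge0 (H : egraph d) w : 0 <= Psi R H w.
Proof.
by apply: sumr_ge0 => q _; rewrite mulr_ge0 ?invr_ge0 // addr_ge0 // mulr_ge0 ?invr_ge0.
Qed.

Lemma Psi_ge_half : ~~ heavy_start (crossings s) -> 2^-1 <= Psi R G v.
Proof.
move=> light.
apply: (@le_trans _ _ (\sum_(q in diametrical G) #|diametrical G|%:R^-1 * 2^-1)).
  by rewrite sumr_const -[leRHS]mulr_natl mulrA mulfV ?mul1r // pnatr_eq0 -lt0n diametrical_neq0.
apply: ler_sum => q q_diam; rewrite ler_wpM2l ?invr_ge0 //.
case: (diametrical_start light q_diam) => ->; rewrite eqxx mulr1.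
  by rewrite lerDl mulr_ge0 ?invr_ge0.
by rewrite lerDr mulr_ge0 ?invr_ge0.
Qed.

End PsiBounds.

(** * Walks with the same trace *)
Section Words.
Variable d : nat.
Local Notation dir := (direction d).
Implicit Types (v w x : 'rV[int]_d) (s t r : seq dir) (a z : dir).

Definition opp_dir a : dir := (a.1, ~~ a.2).
Definition back s := rev (map opp_dir s).

Lemma opp_dirK : involutive opp_dir.
Proof. by case=> i b; rewrite /opp_dir negbK. Qed.

Lemma step_opp a : step (opp_dir a) = - step a.
Proof. by rewrite /step /=; case: a.2; rewrite /= ?expr0 ?expr1 !(scale1r, scaleN1r) ?opprK. Qed.

Lemma back_cat s t : back (s ++ t) = back t ++ back s.
Proof. by rewrite /back map_cat rev_cat. Qed.

Lemma back_cons a s : back (a :: s) = rcons (back s) (opp_dir a).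
Proof. by rewrite /back /= rev_cons. Qed.

Lemma backK : involutive back.
Proof. by move=> s; rewrite /back map_rev revK mapK //; exact: opp_dirK. Qed.

Lemma disp_back s : disp (back s) = - disp s.
Proof.
elim: s => [|a s IHs]; first by rewrite disp_nil oppr0.
by rewrite back_cons -cats1 disp_cat !disp_cons disp_nil IHs step_opp addr0 opprD addrC.
Qed.

(** The vertices and edges of a trace as lists, which split over a concatenation of
words. *)
Fixpoint verts v s : seq (lattice d) :=
  v :: (if s is a :: r then verts (v + step a) r else [::]).

Fixpoint edges v s : seq {fset lattice d} :=
  if s is a :: r then [fset (v : lattice d); (v + step a)%R]%fset :: edges (v + step a) r
  else [::].

Lemma mkseqS T (f : nat -> T) n : mkseq f n.+1 = f 0%N :: mkseq (fun i => f i.+1) n.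
Proof. by rewrite /mkseq /= (iotaDl 1 0) -map_comp. Qed.

Lemma vertsE v s : verts v s = mkseq (fun i => v + disp (take i s)) (size s).+1.
Proof.
elim: s v => [|a s IHs] v; first by rewrite /mkseq /= disp_nil addr0.
rewrite mkseqS take0 disp_nil addr0 /= IHs; congr (_ :: _).
by apply: eq_mkseq => i; rewrite disp_cons addrA.
Qed.

Lemma edgesE v s : edges v s =
  mkseq (fun i => [fset ((v + disp (take i s))%R : lattice d);
                        (v + disp (take i.+1 s))%R]%fset) (size s).
Proof.
elim: s v => [|a s IHs] v //.
rewrite mkseqS /= take0 disp_nil addr0 disp_cons disp_nil addr0 IHs; congr (_ :: _).
by apply: eq_mkseq => i; rewrite !disp_cons !addrA.
Qed.

Lemma trace_verts n v (s : n.-tuple dir) : gV (trace v s) =i verts v s.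
Proof.
move=> x; rewrite vertsE size_tuple; apply/imfsetP/mapP => [[i _ ->]|[i]].
  by exists (i : nat); [rewrite mem_iota ltn_ord | rewrite positionE // -ltnS].
rewrite mem_iota => /andP[_ lt_in] ->; exists (Ordinal lt_in) => //.
by rewrite positionE.
Qed.

Lemma trace_edges n v (s : n.-tuple dir) : gE (trace v s) =i edges v s.
Proof.
move=> e; rewrite edgesE size_tuple; apply/imfsetP/mapP => [[i _ ->]|[i]].
  exists (i : nat); first by rewrite mem_iota ltn_ord.
  by rewrite !positionE // ltnW.
rewrite mem_iota => /andP[_ lt_in] ->; exists (Ordinal lt_in) => //.
by rewrite !positionE // ltnW.
Qed.

Lemma egraph_inj (G H : egraph d) : gV G = gV H -> gE G = gE H -> G = H.
Proof.
case: G H => [V E p] [V' E' p'] /= eqV eqE; rewrite -{}eqV -{}eqE in p' *.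
by congr EGraph; exact: bool_irrelevance.
Qed.

(** Walks of different lengths, given as sequences, have traces that can be compared
by equality. *)
Definition wtrace v s := trace v (in_tuple s).

Lemma trace_wtrace n v (s : n.-tuple dir) : trace v s = wtrace v s.
Proof. by apply: egraph_inj; apply/fsetP => x; rewrite ?(trace_verts, trace_edges). Qed.

Lemma eq_wtrace v w s t : verts v s =i verts w t -> edges v s =i edges w t ->
  wtrace v s = wtrace w t.
Proof.
move=> eqV eqE; apply: egraph_inj; apply/fsetP => x.
  by rewrite !trace_verts eqV.
by rewrite !trace_edges eqE.
Qed.

Lemma start_in_verts v s : v \in verts v s.
Proof. by case: s => [|a s]; rewrite inE eqxx. Qed.

Lemma mem_verts_cat x v s t :
  (x \in verts v (s ++ t)) = (x \in verts v s) || (x \in verts (v + disp s) t).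
Proof.
elim: s v => [|a s IHs] v /=.
  rewrite disp_nil addr0 inE; case: eqP => [->|] //=; by rewrite start_in_verts.
by rewrite !inE IHs disp_cons addrA orbA.
Qed.

Lemma edges_cat v s t : edges v (s ++ t) = edges v s ++ edges (v + disp s) t.
Proof.
elim: s v => [|a s IHs] v /=; first by rewrite disp_nil addr0.
by rewrite IHs disp_cons addrA.
Qed.

Lemma mem_verts_back v s : verts (v + disp s) (back s) =i verts v s.
Proof.
elim: s v => [|a s IHs] v x; first by rewrite disp_nil addr0.
rewrite back_cons -cats1 mem_verts_cat disp_cons addrA IHs disp_back addrK /= !inE.
rewrite step_opp addrK; have in_s := start_in_verts (v + step a) s.
have [->|_] := eqVneq x (v + step a); first by rewrite in_s !orbT.
by rewrite /= orbC.
Qed.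

Lemma mem_edges_back v s : edges (v + disp s) (back s) =i edges v s.
Proof.
elim: s v => [|a s IHs] v e //.
rewrite back_cons -cats1 edges_cat mem_cat disp_cons addrA IHs disp_back addrK /= !inE.
by rewrite step_opp addrK orbC fsetUC.
Qed.

(** Reversal: the walk with steps [back s] starts where the walk with steps [s]
ends, and runs through it backwards. *)
Lemma wtrace_back v s : wtrace (v + disp s) (back s) = wtrace v s.
Proof. exact: eq_wtrace (mem_verts_back v s) (mem_edges_back v s). Qed.

(** On the right the edge of [a] is traversed twice at the beginning, on the left the
edge of [z] is traversed twice at the end; each of the two edges is traversed at
least once by both walks. *)
Lemma wtrace_slide v a t z :
  wtrace (v + step a) (opp_dir a :: t ++ [:: z; opp_dir z])
  = wtrace v [:: a, opp_dir a & t ++ [:: z]].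
Proof.
have -> : t ++ [:: z; opp_dir z] = (t ++ [:: z]) ++ [:: opp_dir z] by rewrite -catA.
set r := t ++ [:: z].
have end_in : v + disp t \in verts v r.
  by rewrite mem_verts_cat start_in_verts orbT.
have edge_in : [fset ((v + disp t)%R : lattice d); (v + disp t + step z)%R]%fset \in edges v r.
  by rewrite edges_cat mem_cat /= inE eqxx orbT.
have dispr : disp r = disp t + step z by rewrite disp_cat disp_cons disp_nil addr0.
apply: eq_wtrace => x /=; rewrite step_opp addrK.
  rewrite !inE mem_verts_cat /= !inE dispr addrA step_opp addrK.
  have := start_in_verts v r; have : v + disp t + step z \in verts v r.
    rewrite -addrA -dispr -[r]cats0 mem_verts_cat /=  disp_cat disp_nil addr0.
    by rewrite inE eqxx orbT.
  have [->|_] := eqVneq x (v + disp t + step z) => [->|_]; first by rewrite !orbT.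
  have [->|_] := eqVneq x (v + disp t); first by rewrite end_in !orbT.
  have [->|_] := eqVneq x v => [->|_]; first by rewrite !orbT.
  by rewrite !orbF.
rewrite !inE edges_cat mem_cat /= !inE dispr addrA step_opp addrK.
rewrite [[fset (v + step a)%R; v]%fset]fsetUC; case: (x == [fset v; (v + step a)%R]%fset) => //=.
rewrite [[fset (v + disp t + step z)%R; _]%fset]fsetUC.
have [->|_] := eqVneq x [fset (v + disp t)%R; (v + disp t + step z)%R]%fset.
  by rewrite edge_in.
by rewrite orbF.
Qed.

End Words.

(** * Backtracks at the ends of a walk *)
Section Averaging.
Variables (R : realType) (d : nat).
Hypothesis d_gt0 : (0 < d)%N.
Local Notation dir := (direction d).
Local Notation D := (#|{: direction d}|%:R : R).

Lemma card_dir : #|{: dir}| = (2 * d)%N.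
Proof. by rewrite card_prod card_ord card_bool mulnC. Qed.

Lemma card_dir_gt0 : (0 < #|{: dir}|)%N.
Proof. by rewrite card_dir muln_gt0. Qed.

Lemma card_dirR_gt0 : 0 < D. Proof. by rewrite ltr0n card_dir_gt0. Qed.

Lemma sum_dir_const (x : R) : \sum_(a : dir) x = D * x.
Proof. by rewrite sumr_const -(mulr_natl x). Qed.

Lemma mean_back n (g : seq dir -> R) : mean n (fun s => g (back s)) = mean n g.
Proof.
rewrite -[RHS]mean_rev.
by rewrite -(mean_map n (fun s => g (rev s)) (inv_inj (@opp_dirK d))).
Qed.

Definition backtracks (s : seq dir) : bool :=
  if s is [:: a, b & _] then b == opp_dir a else false.

Lemma mean_backtracks k (g : seq dir -> R) :
  mean k.+3 (fun s => (backtracks s)%:R * g s)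
  = D^-1 ^+ 3 * \sum_a \sum_z mean k (fun t => g [:: a, opp_dir a & t ++ [:: z]]).
Proof.
rewrite [LHS]/= mulr_sumr mulr_sumr; apply: eq_bigr => a _.
rewrite (bigD1 (opp_dir a)) //= [X in _ + X]big1 => [|b /negPf ne_b]; last first.
  rewrite big1 ?mulr0 // => c _; rewrite -[RHS](mean0 R dir k); apply: eq_mean => s _.
  by rewrite ne_b mul0r.
rewrite addr0 -[X in _ * (_ * X)]/(mean k.+1 (fun s =>
  (opp_dir a == opp_dir a)%:R * g [:: a, opp_dir a & s])).
rewrite -[k.+1]addn1 mean_cat /=.
under eq_mean => t _ do under eq_bigr => z _ do rewrite eqxx mul1r.
rewrite meanZ mean_sum !exprS expr0 mulr1 -!mulrA.
by [].
Qed.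

Lemma sum_backtracks (r : seq dir) : (0 < size r)%N ->
  \sum_z (backtracks (opp_dir z :: r))%:R = 1 :> R.
Proof.
case: r => // y r _; rewrite (bigD1 y) //= opp_dirK eqxx big1 ?addr0 // => z /negPf ne_z.
by rewrite opp_dirK eq_sym ne_z.
Qed.

Lemma back_backtrack a (t : seq dir) z :
  back [:: a, opp_dir a & t ++ [:: z]] = opp_dir z :: back t ++ [:: a; opp_dir a].
Proof.
by rewrite !back_cons back_cat opp_dirK -!cats1 -!catA.
Qed.

Lemma prob_backtracks k : mean k.+3 (fun s => (backtracks s)%:R) = D^-1.
Proof.
have := mean_backtracks k (fun=> 1).
under eq_mean do rewrite mulr1.
move=> ->; under eq_bigr do under eq_bigr do rewrite (mean_cst card_dir_gt0).
have D_neq0 := lt0r_neq0 card_dirR_gt0.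
by rewrite !sum_dir_const; field.
Qed.

Lemma prob_backtracks2 k :
  mean k.+3 (fun s => (backtracks s)%:R * (backtracks (back s))%:R) = D^-1 ^+ 2.
Proof.
rewrite mean_backtracks.
under eq_bigr => a _.
  under eq_bigr => z _ do under eq_mean => t _ do rewrite back_backtrack.
  rewrite -mean_sum; under eq_mean => t _.
    rewrite sum_backtracks; last by rewrite size_cat addn2.
    over.
  rewrite (mean_cst card_dir_gt0); over.
have D_neq0 := lt0r_neq0 card_dirR_gt0.
by rewrite sum_dir_const; field.
Qed.

Lemma step_inj : injective (@step d).
Proof.
move=> [i b] [j c] /rowP eq_s.
have := eq_s i; rewrite !mxE !eqxx /= mulr1.
have [eq_ij|] := eqVneq i j; last by case: b {eq_s}; case: c.
by rewrite -eq_ij mulr1; case: b {eq_s}; case: c.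
Qed.

(** When all letters but the first are fixed, at most one first letter leads to
[x]. *)
Lemma disp_prob k (x : 'rV[int]_d) : (0 < k)%N ->
  mean k (fun s : seq dir => (disp s == x)%:R) <= D^-1.
Proof.
case: k => // k _; rewrite /= -[leRHS]mulr1 ler_pM2l ?invr_gt0 ?card_dirR_gt0 //.
rewrite -mean_sum -[leRHS](mean_cst card_dir_gt0 k); apply: ler_mean => s _.
have [a aP|none] := pickP (fun a : dir => disp (a :: s) == x); last first.
  by rewrite big1 // => a _; rewrite none.
rewrite (bigD1 a) //= big1 ?addr0 ?lern1 ?leq_b1 // => b ne_ba.
case: eqP => // eq_b; case/eqP: ne_ba; apply: step_inj.
by move/eqP: aP; rewrite -eq_b !disp_cons => /addIr.
Qed.

End Averaging.

(** * Averaging the source over a box *)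
Section BoxSum.
Variables (R : realType) (d : nat).
Local Notation dir := (direction d).

Lemma disp_bound (s : seq dir) i : `|disp s ord0 i| <= (size s)%:Z.
Proof.
elim: s => [|a s IHs]; first by rewrite disp_nil mxE.
rewrite disp_cons mxE; apply: le_trans (ler_normD _ _) _.
rewrite -[(size _)%:Z]/(1 + (size s)%:Z) lerD // !mxE normrM normr_sign mul1r.
by case: (_ && _).
Qed.

(** Shifting the box by the offset [o] makes the box of side [M + o + o] with offset
[o] an enlargement of the box of side [M] with offset 0 by [o] in all
directions. *)
Definition box_sum M o (g : 'rV[int]_d -> R) : R :=
  \sum_(u : {ffun 'I_d -> 'I_M}) g (\row_i ((u i)%:Z - o%:Z)).

Lemma box_sum_cst M o x : box_sum M o (fun=> x) = (M ^ d)%:R * x.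
Proof. by rewrite /box_sum sumr_const card_ffun !card_ord mulr_natl. Qed.

Lemma ler_box_sum M o g h : (forall v, g v <= h v) -> box_sum M o g <= box_sum M o h.
Proof. by move=> le_gh; apply: ler_sum. Qed.

Lemma box_sumD M o g h : box_sum M o (fun v => g v + h v) = box_sum M o g + box_sum M o h.
Proof. exact: big_split. Qed.

Lemma box_sum_shift M o (c : 'rV[int]_d) (g : 'rV[int]_d -> R) :
  (forall i, `|c ord0 i| <= o%:Z) -> (forall v, 0 <= g v) ->
  box_sum M 0 g <= box_sum (M + o + o) o (fun v => g (v + c)).
Proof.
move=> c_le g_ge0.
have lt_h (u : {ffun 'I_d -> 'I_M}) i :
    (absz ((u i)%:Z + o%:Z - c ord0 i)%R < M + o + o)%N.
  have := c_le i; have := ltn_ord (u i); lia.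
pose h u : {ffun 'I_d -> 'I_(M + o + o)} := [ffun i => Ordinal (lt_h u i)].
have hE u i : (h u i)%:Z = (u i)%:Z + o%:Z - c ord0 i.
  by rewrite ffunE /=; have := c_le i; lia.
have h_inj : injective h.
  move=> u w eq_h; apply/ffunP => i; apply: val_inj => /=.
  by have := hE u i; rewrite eq_h hE; lia.
rewrite /box_sum [leRHS](bigID (mem (h @: predT))) /=.
rewrite -[leLHS]addr0 lerD ?sumr_ge0 // big_imset /=; last by move=> u w _ _; exact: h_inj.
rewrite le_eqVlt; apply/orP; left; apply/eqP.
rewrite [RHS](eq_bigl xpredT) => [|u]; last by rewrite inE.
apply: eq_bigr => u _; congr g; apply/rowP => i; rewrite !mxE hE (_ : c 0 i = c ord0 i) //.
by rewrite subr0; ring.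
Qed.

Lemma box_mean_shift M o n (g : seq dir -> 'rV[int]_d -> R) (c : seq dir -> 'rV[int]_d) :
  (forall s v, 0 <= g s v) ->
  (forall s i, size s = n -> `|c s ord0 i| <= o%:Z) ->
  box_sum M 0 (fun v => mean n (fun s => g s v))
  <= box_sum (M + o + o) o (fun v => mean n (fun s => g s (v + c s))).
Proof.
move=> g_ge0 c_le; rewrite /box_sum -!mean_sum; apply: ler_mean => s sz_s.
exact: (box_sum_shift M (fun i => c_le s i sz_s) (g_ge0 s)).
Qed.

End BoxSum.

(** * The upper bound in a box *)
Section UpperBound.
Variables (R : realType) (d : nat) (Phi : egraph d -> lattice d -> R).
Hypothesis d_gt0 : (0 < d)%N.
Local Notation dir := (direction d).
Local Notation D := (#|{: direction d}|%:R : R).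

Hypothesis Phi_ge0 : forall G w, 0 <= Phi G w.
Hypothesis Phi_le1 : forall G (l : seq (lattice d)), uniq l -> \sum_(w <- l) Phi G w <= 1.

Let f (v : 'rV[int]_d) s := Phi (wtrace v s) v.

Lemma Phi_single_le1 G w : Phi G w <= 1.
Proof. by have := @Phi_le1 G [:: w] isT; rewrite big_seq1. Qed.

Lemma Phi_pair_le1 G (v w : lattice d) : v != w -> Phi G v + Phi G w <= 1.
Proof.
move=> ne_vw; have := @Phi_le1 G [:: v; w]; rewrite big_cons big_seq1; apply.
by rewrite /= inE ne_vw.
Qed.

(** Each walk is paired with its reversal: in the same graph, the probabilities of
the two ends sum to at most 1, except when the walk is closed. *)
Lemma symmetric_part M o n (c : seq dir -> R) : (n <= o)%N ->
  (forall s, 0 <= c s) -> (forall s, c (back s) = c s) ->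
  2 * box_sum M 0 (fun v => mean n (fun s => c s * f v s))
  <= ((M + o + o) ^ d)%:R * (mean n c + mean n (fun s => c s * (disp s == 0)%:R)).
Proof.
move=> le_no c_ge0 c_back; rewrite -(@box_sum_cst R d (M + o + o) o) -meanD mulr2n mulrDl !mul1r.
have cf_ge0 s v : 0 <= c s * f v s by exact: mulr_ge0 (c_ge0 s) (Phi_ge0 _ _).
have disp_le (s : seq dir) i : size s = n -> `|disp s ord0 i| <= o%:Z.
  by move=> sz_s; apply: le_trans (disp_bound s i) _; rewrite sz_s lez_nat.
have zero_le (s : seq dir) i : size s = n -> `|(0 : 'rV[int]_d) ord0 i| <= o%:Z.
  by rewrite mxE normr0.
have le1 := box_mean_shift M cf_ge0 zero_le.
have cfb_ge0 s v : 0 <= c s * f v (back s) by exact: mulr_ge0 (c_ge0 s) (Phi_ge0 _ _).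
have := box_mean_shift M cfb_ge0 disp_le.
have -> : (fun v => mean n (fun s => c s * f v (back s)))
    = (fun v => mean n (fun s => c s * f v s)).
  apply/funext => v; rewrite -[RHS]mean_back.
  by apply: eq_mean => s _; rewrite c_back.
move=> le2.
apply: le_trans (lerD le1 le2) _; rewrite -box_sumD; apply: ler_box_sum => v.
rewrite -meanD; apply: ler_mean => s sz_s; rewrite -mulrDr -[X in _ <= X + _]mulr1 -mulrDr.
apply: ler_wpM2l => //; rewrite addr0 /f wtrace_back.
have [->|ne0] := eqVneq (disp s) 0; first by rewrite addr0 lerD ?Phi_single_le1.
rewrite addr0 Phi_pair_le1 //; apply: contraNneq ne0 => /esym/eqP.
by rewrite -subr_eq0 addrAC subrr add0r.
Qed.


Variable k : nat.
Hypothesis k_gt0 : (0 < k)%N.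

Let spur a t z : seq dir := [:: a, opp_dir a & t ++ [:: z]].
Let P1 M a z := box_sum M 0 (fun v => mean k (fun t => f v (spur a t z))).
Let P2 M a z := box_sum M 0 (fun v => mean k (fun t => f v (back (spur a t z)))).

Lemma disp_spur a t z : disp (spur a t z) = disp t + step z.
Proof. by rewrite /spur !disp_cons step_opp addNKr disp_cat disp_cons disp_nil addr0. Qed.

Lemma step_neq0 (a : dir) : step a != 0.
Proof.
apply/eqP => /rowP/(_ a.1)/eqP; rewrite !mxE !eqxx mulr1.
by case: a => i [].
Qed.

(** The two points in each of the pairs [v], [v + step a] and [v + disp t],
[v + disp t + step z] are distinct, so the sum is at most 2; it is at most 1
unless one of the four remaining coincidences occurs. *)
Lemma four_points G (v : 'rV[int]_d) a (t : seq dir) z :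
  Phi G v + Phi G (v + disp t) + Phi G (v + disp (spur a t z)) + Phi G (v + step a)
  <= 1 + ((disp t == 0)%:R + (disp t == - step z)%:R + (disp t == step a)%:R
          + (disp t == step a - step z)%:R).
Proof.
have addv_eq x y : (v + x == v + y) = (x == y) by rewrite (inj_eq (addrI v)).
have v_eq x : (v == v + x) = (x == 0) by rewrite -[X in X == _]addr0 addv_eq eq_sym.
have le01 : Phi G v + Phi G (v + step a) <= 1.
  by apply: Phi_pair_le1; rewrite v_eq step_neq0.
have le23 : Phi G (v + disp t) + Phi G (v + disp (spur a t z)) <= 1.
  by apply: Phi_pair_le1; rewrite addv_eq disp_spur -subr_eq0 opprD addNKr oppr_eq0 step_neq0.
have le_all : uniq [:: v; v + step a; v + disp t; v + disp (spur a t z) : lattice d] ->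
    Phi G v + (Phi G (v + step a) + (Phi G (v + disp t) + Phi G (v + disp (spur a t z)))) <= 1.
  by move=> /(Phi_le1 G); rewrite !big_cons big_nil addr0.
have e1 : (v == v + disp t) = (disp t == 0) by rewrite v_eq.
have e2 : (v == v + disp (spur a t z)) = (disp t == - step z) by rewrite v_eq disp_spur addr_eq0.
have e3 : (v + step a == v + disp t) = (disp t == step a) by rewrite addv_eq eq_sym.
have e4 : (v + step a == v + disp (spur a t z)) = (disp t == step a - step z).
  by rewrite addv_eq disp_spur -subr_eq eq_sym.
have e5 : (v + disp t == v + disp (spur a t z)) = false.
  by rewrite addv_eq disp_spur -subr_eq0 opprD addNKr oppr_eq0 (negPf (step_neq0 z)).
move: le_all; rewrite /= !inE v_eq (negPf (step_neq0 a)) e1 e2 e3 e4 e5 /=.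
by do 4!case: (_ == _) => //=; rewrite ?(addr0, add0r); do ?[move=> /(_ isT)]; lra.
Qed.

(** After the substitution of [back t] for [t], the words behind [P1 M a z],
[P2 M a z], [P1 M z a] and [P2 M z a] are, up to a translation of the source, four
walks with the trace of the word [spur a t z] from [v], whose sources are the
points of [four_points]. *)
Lemma four_starts M o a z : (k.+3 <= o)%N ->
  P1 M a z + P1 M z a + P2 M a z + P2 M z a
  <= ((M + o + o) ^ d)%:R * (1 + 4 * D^-1).
Proof.
move=> le_ko.
have norm_step (b : dir) i : `|step b ord0 i| <= 1.
  have := disp_bound [:: b] i; by rewrite disp_cons disp_nil addr0.
have bound (c : seq dir -> 'rV[int]_d) (g : seq dir -> 'rV[int]_d -> R) h :
    (forall t v, 0 <= g t v) ->
    (forall t i, size t = k -> `|c t ord0 i| <= (k.+1)%:Z) ->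
    (forall t v, g t (v + c t) = h t v) ->
    box_sum M 0 (fun v => mean k (fun t => g t v))
    <= box_sum (M + o + o) o (fun v => mean k (fun t => h t v)).
  move=> g_ge0 c_le gh.
  have c_le' t i : size t = k -> `|c t ord0 i| <= o%:Z.
    by move=> sz_t; apply: le_trans (c_le t i sz_t) _; rewrite lez_nat; lia.
  apply: le_trans (box_mean_shift M g_ge0 c_le') _.
  by apply: ler_box_sum => v; apply: ler_mean => t _; rewrite gh.
pose T v t := wtrace v (spur a t z).
have le1 : P1 M a z <= box_sum (M + o + o) o (fun v => mean k (fun t => Phi (T v t) v)).
  apply: (bound (fun=> 0)) => [t v|t i _|t v]; first exact: Phi_ge0.
    by rewrite mxE normr0.
  by rewrite addr0.
have le2 : P2 M a z <=
    box_sum (M + o + o) o (fun v => mean k (fun t => Phi (T v t) (v + disp (spur a t z)))).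
  apply: (bound (fun t => disp (spur a t z))) => [t v|t i sz_t|t v]; first exact: Phi_ge0.
    rewrite disp_spur mxE; apply: le_trans (ler_normD _ _) _.
    by apply: le_trans (lerD (disp_bound t i) (norm_step z i)) _; rewrite sz_t; lia.
  by rewrite /f wtrace_back.
have le3 : P2 M z a <=
    box_sum (M + o + o) o (fun v => mean k (fun t => Phi (T v t) (v + step a))).
  have -> : P2 M z a = box_sum M 0 (fun v =>
      mean k (fun t => f v (opp_dir a :: t ++ [:: z; opp_dir z]))).
    rewrite /P2; apply: eq_bigr => u _; rewrite -mean_back.
    by apply: eq_mean => t _; rewrite /spur back_backtrack backK.
  apply: (bound (fun t => step a)) => [t v|t i sz_t|t v]; first exact: Phi_ge0.
      by apply: le_trans (norm_step a i) _; lia.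
  by rewrite /f wtrace_slide.
have le4 : P1 M z a <=
    box_sum (M + o + o) o (fun v => mean k (fun t => Phi (T v t) (v + disp t))).
  have -> : P1 M z a = box_sum M 0 (fun v =>
      mean k (fun t => f v (back (opp_dir a :: t ++ [:: z; opp_dir z])))).
    rewrite /P1; apply: eq_bigr => u _; rewrite -mean_back.
    by apply: eq_mean => t _; rewrite -{2}[t]backK -back_backtrack backK.
  apply: (bound (@disp d)) => [t v|t i sz_t|t v]; first exact: Phi_ge0.
    by apply: le_trans (disp_bound t i) _; rewrite sz_t; lia.
  rewrite /f /T -wtrace_slide; congr (Phi _ _).
  rewrite -[in RHS]wtrace_back; congr wtrace.
  rewrite disp_cons disp_cat !disp_cons disp_nil !step_opp addr0 subrr addr0.
  by rewrite addrA addrK.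
apply: le_trans (lerD (lerD (lerD le1 le4) le2) le3) _.
rewrite -!box_sumD -(@box_sum_cst R d (M + o + o) o); apply: ler_box_sum => v.
rewrite -!meanD; apply: le_trans (ler_mean (fun t _ => four_points (T v t) v a t z)) _.
rewrite !meanD (mean_cst (card_dir_gt0 d_gt0)) lerD2l.
have p x := disp_prob R d_gt0 x k_gt0.
have := p 0; have := p (- step z); have := p (step a); have := p (step a - step z).
move: (mean _ _) (mean _ _) (mean _ _) (mean _ _) => x1 x2 x3 x4; lra.
Qed.

(** Let E be the event that the walk begins with a backtrack, and E' its reversal.
Outside both events, pairing a walk with its reversal gives 1/2.  The success
probabilities on E and on E' are averages of [P1] and [P2], and together they are
at most about half the probability of E instead of half the sum of both
probabilities: this is the gain, of order 1/D for D = 2d directions. *)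
Lemma box_sum_success M :
  2 * box_sum M 0 (fun v => mean k.+3 (f v))
  <= ((M + k.+3 + k.+3) ^ d)%:R * (1 - D^-1 + 5 * D^-1 ^+ 2 + return_prob R d k.+3).
Proof.
set K := ((M + k.+3 + k.+3) ^ d)%:R; have K_ge0 : 0 <= K by rewrite ler0n.
pose E (s : seq dir) : R := (backtracks s)%:R; pose c s := (1 - E s) * (1 - E (back s)).
have E01 s : 0 <= E s <= 1 by rewrite ler0n lern1 leq_b1.
have c_ge0 s : 0 <= c s.
  by have /andP[? ?] := E01 s; have /andP[? ?] := E01 (back s); rewrite mulr_ge0 ?subr_ge0.
have c_back s : c (back s) = c s by rewrite /c backK mulrC.
have Csum := symmetric_part M (leqnn k.+3) c_ge0 c_back.
have mean_c : mean k.+3 c = 1 - 2 * D^-1 + D^-1 ^+ 2.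
  have -> : mean k.+3 c = mean k.+3 (fun s =>
      1 + (- 1 * E s + (- 1 * E (back s) + E s * E (back s)))).
    by apply: eq_mean => s _; rewrite /c; ring.
  rewrite !meanD !meanZ (mean_cst (card_dir_gt0 d_gt0)) mean_back.
  by rewrite prob_backtracks // prob_backtracks2 //; ring.
have mean_c0 : mean k.+3 (fun s => c s * (disp s == 0)%:R) <= return_prob R d k.+3.
  apply: ler_mean => s _; rewrite ler_piMl ?ler0n // /c.
  have /andP[? ?] := E01 s; have /andP[? ?] := E01 (back s).
  by rewrite mulr_ile1 ?subr_ge0 // lerBlDr lerDl.
have swap (Q : dir -> dir -> 'rV[int]_d -> R) :
    box_sum M 0 (fun v => D^-1 ^+ 3 * \sum_a \sum_z Q a z v)
    = D^-1 ^+ 3 * \sum_a \sum_z box_sum M 0 (Q a z).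
  rewrite /box_sum -mulr_sumr; congr (_ * _); rewrite exchange_big /=.
  by apply: eq_bigr => a _; rewrite exchange_big.
have E1 : box_sum M 0 (fun v => mean k.+3 (fun s => E s * f v s))
    = D^-1 ^+ 3 * \sum_a \sum_z P1 M a z.
  by rewrite -swap; apply: eq_bigr => u _; rewrite mean_backtracks.
have E2 : box_sum M 0 (fun v => mean k.+3 (fun s => E (back s) * f v s))
    = D^-1 ^+ 3 * \sum_a \sum_z P2 M a z.
  rewrite -swap; apply: eq_bigr => u _.
  rewrite -(mean_backtracks k (fun s => f _ (back s))) -mean_back.
  by apply: eq_mean => s _; rewrite backK.
have Esum : 2 * (D^-1 ^+ 3 * \sum_a \sum_z P1 M a z + D^-1 ^+ 3 * \sum_a \sum_z P2 M a z)
    <= K * (D^-1 + 4 * D^-1 ^+ 2).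
  have D_neq0 := lt0r_neq0 (card_dirR_gt0 R d_gt0).
  have -> : K * (D^-1 + 4 * D^-1 ^+ 2) = D^-1 ^+ 3 * (D * (D * (K * (1 + 4 * D^-1)))).
    by field.
  rewrite -mulrDr mulrCA ler_wpM2l ?exprn_ge0 ?invr_ge0 ?ler0n //.
  rewrite -!sum_dir_const mulr2n mulrDl !mul1r.
  rewrite {2}[\sum_a \sum_z P1 M a z]exchange_big {2}[\sum_a \sum_z P2 M a z]exchange_big /=.
  rewrite -!big_split /=; apply: ler_sum => a _; rewrite -!big_split; apply: ler_sum => z _ /=.
  apply: le_trans (four_starts M a z (leqnn _)).
  by rewrite le_eqVlt; apply/orP; left; apply/eqP; ring.
(* Walks in both events are counted twice, which only increases the right-hand side. *)
have split_f : box_sum M 0 (fun v => mean k.+3 (f v)) <=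
    box_sum M 0 (fun v => mean k.+3 (fun s => c s * f v s))
    + (box_sum M 0 (fun v => mean k.+3 (fun s => E s * f v s))
       + box_sum M 0 (fun v => mean k.+3 (fun s => E (back s) * f v s))).
  rewrite -!box_sumD; apply: ler_box_sum => v; rewrite -!meanD; apply: ler_mean => s _.
  rewrite -!mulrDl ler_peMl ?Phi_ge0 // /c.
  have -> : (1 - E s) * (1 - E (back s)) + (E s + E (back s)) = 1 + E s * E (back s) by ring.
  by rewrite lerDl mulr_ge0 // ler0n.
rewrite E1 E2 in split_f.
have Csum' : 2 * box_sum M 0 (fun v => mean k.+3 (fun s => c s * f v s))
    <= K * (1 - 2 * D^-1 + D^-1 ^+ 2 + return_prob R d k.+3).
  apply: le_trans Csum _; rewrite -/K ler_wpM2l // mean_c lerD2l; exact: mean_c0.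
move: split_f Esum Csum'.
set A := box_sum _ _ _; set B := box_sum _ _ _; set x := D^-1; set y := return_prob _ _ _.
set S := _ + _; move=> le_A le_S le_B.
apply: le_trans (ler_wpM2l _ le_A) _ => //; rewrite mulrDr.
apply: le_trans (lerD le_B le_S) _; rewrite -mulrDr le_eqVlt; apply/orP; left; apply/eqP; ring.
Qed.

End UpperBound.

(** * From a box to all sources *)
Section Ratio.
Variable R : realType.

Lemma bernoulli_le (y : R) n : 0 <= y <= 1 -> 1 - n%:R * y <= (1 - y) ^+ n.
Proof.
case/andP=> y_ge0 y_le1; elim: n => [|n IHn]; first by rewrite mul0r subr0 expr0.
rewrite exprS; apply: le_trans (ler_wpM2l _ IHn); last by rewrite subr_ge0.
have -> : (1 - y) * (1 - n%:R * y) = 1 - n.+1%:R * y + n%:R * y ^+ 2.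
  by rewrite -natr1; ring.
by rewrite lerDl mulr_ge0 ?sqr_ge0.
Qed.

(** The volumes of the boxes of sides j * m and (j + 1) * m have a ratio that tends
to 1 as j grows. *)
Lemma box_ratio (x K : R) d m : (0 < m)%N -> 0 <= K ->
  (forall M, x * (M ^ d)%:R <= ((M + m) ^ d)%:R * K) -> x <= K.
Proof.
move=> m_gt0 K_ge0 le_M; rewrite leNgt; apply/negP => lt_Kx.
have x_gt0 : 0 < x := le_lt_trans K_ge0 lt_Kx.
have gap_gt0 : 0 < x - K by rewrite subr_gt0.
have B_ge0 : 0 <= x * d%:R / (x - K).
  by rewrite divr_ge0 ?mulr_ge0 ?ler0n ?(ltW x_gt0) ?(ltW gap_gt0).
have := archi_boundP B_ge0; set j := Num.bound _; rewrite ltr_pdivrMr // => lt_j.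
have j1_gt0 : 0 < j.+1%:R :> R by [].
pose y : R := j.+1%:R^-1.
have y01 : 0 <= y <= 1 by rewrite invr_ge0 ler0n invf_le1 // ler1n.
have scaled : (j * m)%:R = (1 - y) * (j.+1 * m)%:R :> R.
  by rewrite !natrM -natr1 /y -natr1; field; rewrite natr1 lt0r_neq0.
have P_gt0 : 0 < (j.+1 * m)%:R ^+ d :> R by rewrite exprn_gt0 // ltr0n muln_gt0.
have := le_M (j * m)%N; rewrite addnC -mulSn !natrX scaled exprMn mulrA.
rewrite [leRHS]mulrC ler_pM2r // => le_K.
have := le_trans (ler_wpM2l (ltW x_gt0) (bernoulli_le d y01)) le_K.
rewrite mulrBr mulr1 lerBlDl -lerBlDr mulrA -(ler_pM2r j1_gt0) mulfVK ?lt0r_neq0 //.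
by move=> /le_lt_trans/(_ lt_j); rewrite mulrC ltr_pM2r // ltr_nat ltnNge leqnSn.
Qed.
End Ratio.

Section WorstCase.
Variables (R : realType) (d : nat).
Local Notation dir := (direction d).

Lemma success_prob_mean (Phi : egraph d -> lattice d -> R) n v :
  success_prob Phi n v = mean n (fun s => Phi (wtrace v s) v).
Proof.
rewrite mean_tuple card_dir; apply: eq_bigr => s _.
by rewrite trace_wtrace.
Qed.

Lemma return_prob_small n : (12 <= d)%N -> (4 <= n)%N ->
  return_prob R d n <= 2 / d%:R ^+ 2.
Proof.
move=> d_big n_big; have d_gt0 : (0 < d)%N by lia.
have [odd_n|even_n] := boolP (odd n).
  by rewrite return_prob_odd // divr_ge0 ?exprn_ge0 ?ler0n.
rewrite -(even_halfK even_n); apply: le_trans (return_prob_even R d_gt0 _) _.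
have le2 : (2 <= n./2)%N by lia.
by apply: le_trans (beta_nincr R d_gt0 le2) _; rewrite beta_small //; lia.
Qed.

(** The upper bound uses estimators only through finite sums of probabilities.  The
inequality allows for [Psi], which has mass 0 on graphs without diametrical
paths. *)
Definition subestimator (Phi : egraph d -> lattice d -> R) : Prop :=
  (forall G w, 0 <= Phi G w)
  /\ (forall G (l : seq (lattice d)), uniq l -> \sum_(w <- l) Phi G w <= 1).

Lemma estimator_subestimator Phi : is_estimator Phi -> subestimator Phi.
Proof.
move=> est; split=> [G w|G l uniq_l]; first by have [] := est G.
rewrite -lee_fin -sumEFin; have [_ <-] := est G; apply: esum_ge.
exists [set` l]%classic; first by split.
by rewrite fsbig_seq.
Qed.

Lemma Psi_subestimator : subestimator (@Psi R d).
Proof.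
split=> [G w|G l uniq_l]; first exact: Psi_ge0.
rewrite /Psi exchange_big /=.
have hit (u : lattice d) : \sum_(w <- l) (u == w)%:R <= 1 :> R.
  rewrite -natr_sum lern1.
  have -> : (\sum_(w <- l) (u == w) = count_mem u l)%N.
    by rewrite -sum1_count [RHS]big_mkcond; apply: eq_bigr => w _; rewrite eq_sym /=; case: eqP.
  by rewrite count_uniq_mem // leq_b1.
apply: (@le_trans _ _ (\sum_(q in diametrical G) #|diametrical G|%:R^-1)).
  apply: ler_sum => q _; rewrite -mulr_sumr ler_piMr ?invr_ge0 //.
  rewrite big_split /= -!mulr_sumr.
  have := hit (val q.1); have := hit (val (last q.1 q.2)).
  move: (\sum_(w <- l) _) (\sum_(w <- l) _) => x y; lra.
rewrite sumr_const -[leLHS]mulr_natl.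
by have [->|D_gt0] := posnP #|diametrical G|; rewrite ?mul0r // mulfV // pnatr_eq0 -lt0n.
Qed.

Lemma worst_success_le Phi n : subestimator Phi -> (13 <= d)%N -> (4 <= n)%N ->
  (worst_success_prob Phi n <= (2^-1 - 8^-1 / d%:R)%:E)%E.
Proof.
case=> Phi_ge0 Phi_le1 d_big n_big; have d_gt0 : (0 < d)%N by lia.
rewrite leNgt; apply/negP => lt_inf.
have inf_le v : (worst_success_prob Phi n <= (success_prob Phi n v)%:E)%E.
  by apply: ereal_inf_lbound; exists v.
have : worst_success_prob Phi n \is a fin_num.
  rewrite fin_numE -ltNye -ltey (lt_trans _ lt_inf) ?ltNyr //=.
  by apply: le_lt_trans (inf_le 0) _; rewrite ltry.
move=> /fineK; set x := fine _ => xE; rewrite -{}xE in lt_inf inf_le.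
rewrite lte_fin in lt_inf.
have {}inf_le v : x <= success_prob Phi n v by rewrite -lee_fin.
have [k [k_gt0 nE]] : exists k, (0 < k)%N /\ n = k.+3.
  by exists (n - 3)%N; split; lia.
pose K : R := 1 - #|{: dir}|%:R^-1 + 5 * #|{: dir}|%:R^-1 ^+ 2 + return_prob R d n.
(* In terms of y = 1/d the left-hand side is at most 1 - y / 2 + 13 y^2 / 4, hence the
   threshold 13 for the dimension. *)
have y_bound : K <= 1 - 4^-1 / d%:R.
  rewrite /K; apply: le_trans (lerD (lexx _) (return_prob_small _ n_big)) _; first by lia.
  rewrite card_dir natrM invfM; set y := d%:R^-1; rewrite -exprVn -/y.
  have y_gt0 : 0 < y by rewrite invr_gt0 ltr0n.
  have y_le : y * 13 <= 1.
    by rewrite mulrC ler_pdivrMr ?mul1r ?ler_nat ?ltr0n.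
  nra.
have K_ge0 : 0 <= K.
  have D_ge1 : #|{: dir}|%:R^-1 <= 1 :> R by rewrite invf_le1 ?ler1n ?ltr0n card_dir; lia.
  apply: addr_ge0; last by apply: mean_ge0 => s _; rewrite ler0n.
  by apply: addr_ge0; rewrite ?subr_ge0 // mulr_ge0 ?sqr_ge0.
suff le_K : 2 * x <= K by lra.
apply: (@box_ratio R (2 * x) K d (n + n)) => [||M] //; first by lia.
have := box_sum_success d_gt0 Phi_ge0 Phi_le1 k_gt0 M.
rewrite -nE -addnA -/K; apply: le_trans; rewrite -mulrA ler_wpM2l // mulrC.
rewrite -(@box_sum_cst R d M 0); apply: ler_box_sum => v.
by rewrite -success_prob_mean.
Qed.

Lemma worst_success_Psi_ge n : (12 <= d)%N ->
  ((2^-1 - 2^-1 * (4 * (4 * (192 / d%:R))))%:E <= worst_success_prob (@Psi R d) n)%E.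
Proof.
move=> d_big; have d_gt0 : (0 < d)%N by lia.
apply: le_ereal_inf_tmp => _ [v _ <-]; rewrite lee_fin.
apply: (@le_trans _ _ (mean n (fun s : seq dir => 2^-1 + - 2^-1 * (heavy_start (crossings s))%:R))).
  rewrite meanD meanZ (mean_cst (card_dir_gt0 d_gt0)) mulNr lerD2l lerN2.
  by rewrite ler_wpM2l ?invr_ge0 // heavy_prob.
rewrite success_prob_mean; apply: ler_mean => s _.
have [heavy|light] := boolP (heavy_start (crossings s)).
  by rewrite mulr1 subrr Psi_ge0.
by rewrite mulr0 addr0; exact: Psi_ge_half.
Qed.

End WorstCase.

Lemma limn_esup_ub (R : realType) (u : nat -> \bar R) x N :
  (forall n, (N <= n)%N -> (u n <= x)%E) -> (limn_esup u <= x)%E.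
Proof.
move=> le_u; rewrite limn_esup_lim (cvg_lim _ (@cvg_esups_inf R u)) //.
apply: ge_ereal_inf; exists (esups u N); first by exists N.
by apply: ge_ereal_sup => _ [n /= le_Nn <-]; exact: le_u.
Qed.

Lemma limn_einf_lb (R : realType) (u : nat -> \bar R) x :
  (forall n, (x <= u n)%E) -> (x <= limn_einf u)%E.
Proof.
move=> le_u; rewrite limn_einf_lim (cvg_lim _ (@cvg_einfs_sup R u)) //.
apply: le_ereal_sup_tmp; exists (einfs u 0); first by exists 0%N.
by apply: le_ereal_inf_tmp => _ [n _ <-].
Qed.

Theorem theorem1p2 (R : realType) :
  (exists (C : R) (d0 : nat), 0 < C /\
     forall d : nat, (d0 <= d)%N ->
       (`| limn_einf (worst_success_prob (@Psi R d)) - (2^-1)%:E |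
          <= (C / d%:R)%:E)%E)
  /\
  (exists (c : R) (d0 : nat), 0 < c /\
     forall d : nat, (d0 <= d)%N ->
     forall Phi : egraph d -> lattice d -> R, is_estimator Phi ->
       (limn_esup (worst_success_prob Phi) <= (2^-1 - c / d%:R)%:E)%E).
Proof.
split; last first.
  exists 8^-1, 13%N; split=> [|d d_big Phi est]; first by rewrite invr_gt0.
  apply: (@limn_esup_ub _ _ _ 4) => n n_big.
  by apply: worst_success_le n_big => //; exact: estimator_subestimator.
exists (8 * 192), 13%N; split=> [|d d_big]; first by rewrite mulr_gt0 ?ltr0n.
set L := limn_einf _.
have L_ge : ((2^-1 - 2^-1 * (4 * (4 * (192 / d%:R))))%:E <= L)%E.
  by apply: limn_einf_lb => n; apply: worst_success_Psi_ge; lia.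
have L_le : (L <= (2^-1 - 8^-1 / d%:R)%:E)%E.
  apply: le_trans (limn_einf_sup _) (@limn_esup_ub _ _ _ 4 _) => n n_big.
  exact: worst_success_le (@Psi_subestimator R d) d_big n_big.
have : L \is a fin_num.
  by rewrite fin_numE -ltNye -ltey (lt_le_trans _ L_ge) ?ltNyr //= (le_lt_trans L_le) ?ltry.
move=> /fineK LE; move: L_ge L_le; rewrite -{}LE.
set x := fine _; rewrite !lee_fin => x_ge x_le.
have y_ge0 : 0 <= d%:R^-1 :> R by rewrite invr_ge0 ler0n.
rewrite ler_norml.
move: x_ge x_le; set y := d%:R^-1 in y_ge0 *; move=> x_ge x_le.
apply/andP; split; lra.
Qed.
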